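(* Let $F$ be a field of characteristic $2$, let $a,b,c,d\in F^\times$ and let $\tau=\{a,b\}_2+\{c,d\}_2\in K_2(F)/2K_2(F)$. Then $\tau$ is equal to a single symbol in $K_2(F)/4K_2(F)$ (that is, under the embedding $K_2(F)/2K_2(F)\hookrightarrow K_2(F)/4K_2(F)$ described in the context, the image of $\tau$ equals $\{\alpha,\beta\}_4$ for some $\alpha,\beta\in F^\times$) if and only if $\{a,b,c,d\}$ is trivial in $K_4(F)/2K_4(F)$.
   Context: $K_n(F)$ is the $n$-th Milnor $K$-group of $F$; $\{\alpha_1,\dots,\alpha_n\}_{2^m}$ denotes the class of the symbol $\{\alpha_1,\dots,\alpha_n\}$ ($\alpha_i\in F^\times$) in $K_n(F)/2^mK_n(F)$. For $\operatorname{char}(F)=2$, the group $K_2(F)/2K_2(F)$ is regarded as a subgroup of $K_2(F)/4K_2(F)$ via the injective homomorphism $\{a,b\}_2\mapsto\{a,b^2\}_4$, i.e. one identifies $\{a,b\}_2=\{a,b^2\}_4$. It fits in a short exact sequence $0\to K_2(F)/2K_2(F)\to K_2(F)/4K_2(F)\to K_2(F)/2K_2(F)\to 0$ whose second map is $\{a,b\}_4\mapsto\{a,b\}_2$. *)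

(* Defs.v *)
From HB Require Import structures.
From mathcomp Require Import all_boot all_order all_algebra.
From mathcomp Require Import boolp.
From mathcomp.multinomials Require Import freeg.

Set Implicit Arguments.
Unset Strict Implicit.
Unset Printing Implicit Defensive.

Import GRing.Theory.
Local Open Scope ring_scope.

Section Units.
Variable F : fieldType.

Record units := Units { uval :> F; uvalP : uval != 0 }.

HB.instance Definition _ := [isSub for uval].
HB.instance Definition _ := [Choice of units by <:].

Fact uone_subproof : (1 : F) != 0. Proof. exact: oner_neq0. Qed.
Fact umul_subproof (x y : units) : (x : F) * (y : F) != 0.
Proof. by rewrite mulf_neq0 ?uvalP. Qed.
Fact uinv_subproof (x : units) : (x : F)^-1 != 0.
Proof. by rewrite invr_neq0 ?uvalP. Qed.

Definition uone := Units uone_subproof.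
Definition umul x y := Units (umul_subproof x y).
Definition uinv x := Units (uinv_subproof x).

Fact umulA : associative umul.
Proof. by move=> x y z; apply: val_inj; rewrite /= mulrA. Qed.
Fact umul1u : left_id uone umul.
Proof. by move=> x; apply: val_inj; rewrite /= mul1r. Qed.
Fact umulu1 : right_id uone umul.
Proof. by move=> x; apply: val_inj; rewrite /= mulr1. Qed.
Fact umulVu : left_inverse uone uinv umul.
Proof. by move=> x; apply: val_inj; rewrite /= mulVf ?uvalP. Qed.
Fact umuluV : right_inverse uone uinv umul.
Proof. by move=> x; apply: val_inj; rewrite /= mulfV ?uvalP. Qed.

HB.instance Definition _ :=
  isGroup.Build units umulA umul1u umulu1 umulVu umuluV.

Lemma uvalM (x y : units) : uval (x * y)%g = (x : F) * (y : F).
Proof. by []. Qed.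

End Units.

Section Span.
Variables (V : zmodType) (S : V -> Prop).

Inductive zspanned : V -> Prop :=
| zspanned_gen x of S x : zspanned x
| zspanned0 : zspanned 0
| zspannedB x y of zspanned x & zspanned y : zspanned (x - y).

Definition zspan : V -> bool := fun x => `[< zspanned x >].

Lemma zspanP x : reflect (zspanned x) (x \in zspan).
Proof. exact: asboolP. Qed.

Fact zspan_zmod_closed : zmod_closed zspan.
Proof.
split=> [|x y /zspanP xS /zspanP yS]; apply/zspanP; first exact: zspanned0.
exact: zspannedB.
Qed.

HB.instance Definition _ := GRing.isZmodClosed.Build V zspan zspan_zmod_closed.

Definition zquot : zmodType := Quotient.quot (GRing.ZmodClosed.clone V zspan _).
Definition zproj : V -> zquot := \pi_(Quotient.quot (GRing.ZmodClosed.clone V zspan _))%qT.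

Fact zproj_is_zmod_morphism : zmod_morphism zproj.
Proof. by move=> x y; rewrite /zproj raddfB. Qed.
HB.instance Definition _ :=
  GRing.isZmodMorphism.Build V zquot zproj zproj_is_zmod_morphism.

Lemma zproj_eq x y : zproj x = zproj y <-> zspanned (x - y).
Proof.
rewrite /zproj; split=> [/eqP|h]; first by rewrite -Quotient.idealrBE => /zspanP.
by apply/eqP; rewrite -Quotient.idealrBE; apply/zspanP.
Qed.

Lemma zproj_surj y : exists x, zproj x = y.
Proof. by exists (repr y); rewrite /zproj reprK. Qed.

(* The homomorphism out of the quotient induced by f; meaningful only when f is
   additive and vanishes on S. *)
Definition zdesc (W : zmodType) (f : V -> W) : zquot -> W := fun x => f (repr x).

Section Desc.
Variables (W : zmodType) (f : {additive V -> W}).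
Hypothesis fS : forall x, S x -> f x = 0.

Lemma zdescE x : zdesc f (zproj x) = f x.
Proof.
have f0 y : zspanned y -> f y = 0.
  by elim=> [z /fS //||z t _ zf _ tf]; rewrite ?raddf0 ?raddfB ?zf ?tf ?subr0.
apply/eqP; rewrite -subr_eq0 -raddfB; apply/eqP/f0/zproj_eq.
by rewrite /zproj reprK.
Qed.

Lemma zdesc_is_zmod_morphism : zmod_morphism (zdesc f).
Proof.
move=> x y; have [u <-] := zproj_surj x; have [v <-] := zproj_surj y.
by rewrite -raddfB !zdescE raddfB.
Qed.

End Desc.
End Span.

Definition tset (T : Type) n (t : n.-tuple T) (i : 'I_n) (x : T) : n.-tuple T :=
  [tuple if j == i then x else tnth t j | j < n].

Section MilnorK.
Variables (n : nat) (F : fieldType).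
Local Notation U := (units F).

(* The n-th graded piece of the tensor ring of the Z-module F^x modulo the
   two-sided ideal generated by the tensors x (x) (1 - x): the free abelian group
   on n-tuples of units, modulo multilinearity and the Steinberg relation in
   adjacent positions. *)
Inductive milnor_rel : {freeg (n.-tuple U)} -> Prop :=
| milnor_mul (t : n.-tuple U) i x y :
    milnor_rel (<< tset t i (x * y)%g >> - << tset t i x >> - << tset t i y >>)
| milnor_steinberg (t : n.-tuple U) (i j : 'I_n) of
    j = i.+1 :> nat & uval (tnth t i) + uval (tnth t j) = 1 :
    milnor_rel << t >>.

Definition milnorK : zmodType := zquot milnor_rel.

Definition ksym (t : n.-tuple U) : milnorK := zproj milnor_rel << t >>.

Definition multiple (m : nat) (x : milnorK) : Prop := exists y, x = y *+ m.

(* K_n(F) / m K_n(F) *)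
Definition milnorKmod (m : nat) : zmodType := zquot (multiple m).

Definition ksym_mod (m : nat) (t : n.-tuple U) : milnorKmod m :=
  zproj (multiple m) (ksym t).

Lemma ksymM t i x y :
  ksym (tset t i (x * y)%g) = ksym (tset t i x) + ksym (tset t i y).
Proof.
apply/eqP; rewrite /ksym -raddfD; apply/eqP/zproj_eq.
by rewrite opprD addrA; apply/zspanned_gen/milnor_mul.
Qed.

Lemma ksym_steinberg t (i j : 'I_n) : j = i.+1 :> nat ->
  uval (tnth t i) + uval (tnth t j) = 1 -> ksym t = 0.
Proof.
move=> ij st; rewrite /ksym -(raddf0 (zproj milnor_rel)); apply/zproj_eq.
by rewrite subr0; apply/zspanned_gen/(milnor_steinberg ij st).
Qed.

Lemma ksym_modM m t i x y :
  ksym_mod m (tset t i (x * y)%g) =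
    ksym_mod m (tset t i x) + ksym_mod m (tset t i y).
Proof. by rewrite /ksym_mod ksymM raddfD. Qed.

Lemma ksym_mod_steinberg m t (i j : 'I_n) : j = i.+1 :> nat ->
  uval (tnth t i) + uval (tnth t j) = 1 -> ksym_mod m t = 0.
Proof. by move=> ij st; rewrite /ksym_mod (ksym_steinberg ij st) raddf0. Qed.

Lemma milnorKmod_mulrn m (x : milnorKmod m) : x *+ m = 0.
Proof.
have [y <-] := zproj_surj x.
rewrite -raddfMn -(raddf0 (zproj (multiple m))); apply/zproj_eq.
by rewrite subr0; apply: zspanned_gen; exists y.
Qed.

(* The homomorphism K_n(F)/m -> W given on symbols by f; meaningful only when f
   satisfies the hypotheses below. *)
Definition milnor_lift (m : nat) (W : zmodType) (f : n.-tuple U -> W) :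
    milnorKmod m -> W :=
  zdesc (zdesc (fglift (f : n.-tuple U -> zmodule W) : {freeg (n.-tuple U)} -> W)).

Section Lift.
Variables (m : nat) (W : zmodType) (f : n.-tuple U -> W).
Hypothesis fM : forall t i x y,
  f (tset t i (x * y)%g) = f (tset t i x) + f (tset t i y).
Hypothesis fS : forall t (i j : 'I_n), j = i.+1 :> nat ->
  uval (tnth t i) + uval (tnth t j) = 1 -> f t = 0.
Hypothesis fm : forall t, f t *+ m = 0.

Let g : {freeg (n.-tuple U)} -> W := fglift (f : n.-tuple U -> zmodule W).
Let g_add : zmod_morphism g.
Proof. exact: (@lift_is_additive int _ (zmodule W) f). Qed.
HB.instance Definition _ := GRing.isZmodMorphism.Build _ _ g g_add.

Let gU t : g << t >> = f t.
Proof. by rewrite /g liftU scale1r. Qed.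

Let g0 x : milnor_rel x -> g x = 0.
Proof.
case=> [t i a b|t i j ij st]; last by rewrite gU (fS ij st).
by rewrite !raddfB /= !gU fM addrAC addrK subrr.
Qed.

Let h : milnorK -> W := zdesc g.
Let h_add : zmod_morphism h.
Proof. exact: zdesc_is_zmod_morphism g0. Qed.
HB.instance Definition _ := GRing.isZmodMorphism.Build _ _ h h_add.

Let hm x : multiple m x -> h x = 0.
Proof.
case=> y ->; have [u <-] := zproj_surj y.
rewrite raddfMn /= /h (zdescE g0) -(freeg_sumE u) raddf_sum /= -sumrMnl big1 //.
move=> t _; rewrite /g liftU scalezrE.
by rewrite -[LHS]/((f t *~ coeff t u) *+ m) pmulrn mulrzAC -pmulrn fm mul0rz.
Qed.

Lemma milnor_lift_is_zmod_morphism : zmod_morphism (milnor_lift f : milnorKmod m -> W).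
Proof. exact: zdesc_is_zmod_morphism hm. Qed.

Lemma milnor_liftE t : milnor_lift f (ksym_mod m t) = f t.
Proof. exact: etrans (zdescE hm _) (etrans (zdescE g0 _) (gU t)). Qed.

End Lift.
End MilnorK.

Arguments ksym {n F} t.
Arguments ksym_mod {n F} m t.

Section Embedding.
Variable F : fieldType.
Local Notation U := (units F).

Definition sym_sqr (t : 2.-tuple U) : milnorKmod 2 F 4 :=
  ksym_mod 4 [tuple tnth t ord0; (tnth t ord_max ^+ 2)%g].

(* K_2(F)/2 -> K_2(F)/4, {a, b}_2 |-> {a, b^2}_4 (see K2_embE). It is a
   homomorphism over every field, but in general not injective outside
   characteristic 2. *)
Definition K2_emb : milnorKmod 2 F 2 -> milnorKmod 2 F 4 := milnor_lift sym_sqr.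

Lemma tset20 (a b c : U) : tset [tuple a; b] ord0 c = [tuple c; b].
Proof. by apply: eq_from_tnth => i; rewrite tnth_mktuple; case: i => [[|[|]]]. Qed.
Lemma tset21 (a b c : U) : tset [tuple a; b] ord_max c = [tuple a; c].
Proof. by apply: eq_from_tnth => i; rewrite tnth_mktuple; case: i => [[|[|]]]. Qed.

Lemma sym_sqrE t : sym_sqr t = ksym_mod 4 t *+ 2.
Proof.
have tE : t = [tuple tnth t ord0; tnth t ord_max].
  by apply: eq_from_tnth => -[[|[|//]] p]; rewrite [RHS](tnth_nth 1%g) /=;
    congr tnth; apply: val_inj.
rewrite /sym_sqr [in RHS]tE expgS expg1.
move: (tnth t ord0) (tnth t ord_max) => a b.
by rewrite -(tset21 a b (b * b)%g) ksym_modM !tset21 mulr2n.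
Qed.

Fact sym_sqrM t i x y :
  sym_sqr (tset t i (x * y)%g) = sym_sqr (tset t i x) + sym_sqr (tset t i y).
Proof. by rewrite !sym_sqrE ksym_modM mulrnDl. Qed.

Fact sym_sqr_steinberg t (i j : 'I_2) : j = i.+1 :> nat ->
  uval (tnth t i) + uval (tnth t j) = 1 -> sym_sqr t = 0.
Proof. by move=> ij st; rewrite sym_sqrE (ksym_mod_steinberg _ ij st) mul0rn. Qed.

Fact sym_sqr2 t : sym_sqr t *+ 2 = 0.
Proof. by rewrite sym_sqrE -mulrnA milnorKmod_mulrn. Qed.

HB.instance Definition _ := GRing.isZmodMorphism.Build _ _ K2_emb
  (milnor_lift_is_zmod_morphism sym_sqrM sym_sqr_steinberg sym_sqr2).

Lemma K2_embE (a b : U) :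
  K2_emb (ksym_mod 2 [tuple a; b]) = ksym_mod 4 [tuple a; (b ^+ 2)%g].
Proof. exact: milnor_liftE sym_sqrM sym_sqr_steinberg sym_sqr2 _. Qed.

End Embedding.

(* Main.v *)
(* Call a, b, c, d dependent if one of them lies in the subfield generated over
   F^2 by the other three.

   If they are dependent, then {a,b,c,d}_2 = 0, since {.., x, ..} kills F^2 and
   {x, u + v x} reduces to symbols in u and v. Moreover, after changing the
   slots of {a,b} and {c,d}, one reaches {a,b}_2 + {c,d}_2 = {g,x}_2 + {1+g,z}_2,
   whose image in K_2(F)/4 is {g z^2, x^2 (1+g)}_4.

   If they are independent, Zorn's lemma gives commuting derivations D_i of F
   with D_i^2 = D_i that are dual to a, b, c, d. The determinant of logarithmic
   derivatives shows {a,b,c,d}_2 <> 0. To see that the image of {a,b}_2 + {c,d}_2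
   is not a symbol {alpha,beta}_4, lift the D_i to derivations on a subring of
   W_2(F) that is a flat Z/4-lift of F. This makes dlog a well-defined map from
   K_2(F)/4 to 2-forms with W_2(F)-coefficients modulo 2 d(Omega^1). If the image
   were a symbol, then for some 1-form eta the form
   theta = dlog a dlog b + dlog c dlog d + d eta would satisfy
   dlog alpha dlog beta = 2 theta, which forces the Pfaffian of theta to vanish.
   But that Pfaffian is 1 plus a sum of D_i-images, and prod_i (1 - D_i) maps it
   to 1. *)

From HB Require Import structures.
Require Import Defs.
From mathcomp Require Import all_boot all_order all_algebra.
From mathcomp Require Import ring boolp classical_sets.

Set Implicit Arguments.
Unset Strict Implicit.
Unset Printing Implicit Defensive.

Import GRing.Theory.
Local Open Scope ring_scope.

(** * Subfields containing the squares in characteristic 2 *)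

Section Char2.
Variables (F : fieldType) (charF : 2%N \in [pchar F]).

Lemma natr2_char2 : 2%:R = 0 :> F.
Proof. exact: pcharf0. Qed.

Lemma sqrrD_char2 (x y : F) : (x + y) ^+ 2 = x ^+ 2 + y ^+ 2.
Proof. by rewrite sqrrD mulrn_pchar // addr0. Qed.

(* Characteristic 2 gives closure under negation, and x^-1 = x * (x^-1)^2
   gives closure under inverses. *)
Definition subfield2 (E : F -> Prop) :=
  [/\ forall x y, E x -> E y -> E (x + y),
      forall x y, E x -> E y -> E (x * y)
    & forall x, E (x ^+ 2)].

(** When E is a subfield containing the squares, x^2 lies in E, so these elements already form the
    field E(x). *)
Definition adjoin (E : F -> Prop) (x y : F) :=
  exists u v, [/\ E u, E v & y = u + v * x].

Definition squares (y : F) := exists x, y = x ^+ 2.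

Lemma subfield2_squares : subfield2 squares.
Proof.
split=> [_ _ [x ->] [y ->]|_ _ [x ->] [y ->]|x]; last by exists x.
  by exists (x + y); rewrite sqrrD_char2.
by exists (x * y); rewrite exprMn.
Qed.

Section Subfield2.
Variables (E : F -> Prop) (hE : subfield2 E).

Lemma subfield2_0 : E 0. Proof. by case: hE => _ _ /(_ 0); rewrite expr0n. Qed.
Lemma subfield2_1 : E 1. Proof. by case: hE => _ _ /(_ 1); rewrite expr1n. Qed.
Lemma subfield2V x : E x -> E x^-1.
Proof.
case: hE => _ EM Esq Ex; have [->|x0] := eqVneq x 0.
  by rewrite invr0; apply: subfield2_0.
have -> : x^-1 = x * (x^-1) ^+ 2 by field.
by apply: EM => //; exact: Esq.
Qed.
Lemma subfield2_div x y : E x -> E y -> E (x / y).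
Proof. by case: hE => _ EM _ Ex Ey; apply: EM => //; apply: subfield2V. Qed.

Lemma sub_adjoin x y : E y -> adjoin E x y.
Proof. by exists y, 0; split=> //; [exact: subfield2_0|rewrite mul0r addr0]. Qed.
Lemma mem_adjoin x : adjoin E x x.
Proof.
by exists 0, 1; split; [exact: subfield2_0|exact: subfield2_1|rewrite mul1r add0r].
Qed.

Lemma subfield2_adjoin x : subfield2 (adjoin E x).
Proof.
have [ED EM Esq] := hE; split; last by move=> y; apply: sub_adjoin.
  move=> _ _ [u [v [Eu Ev ->]]] [s [t [Es Et ->]]].
  by exists (u + s), (v + t); split; [exact: ED|exact: ED|ring].
move=> _ _ [u [v [Eu Ev ->]]] [s [t [Es Et ->]]].
exists (u * s + (v * t) * x ^+ 2), (u * t + v * s).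
split; last by ring.
  by apply: ED; apply: (EM) => //; exact: (EM).
by apply: ED; exact: (EM).
Qed.

End Subfield2.

(** * Bilinear Steinberg symbols with values killed by 2 *)

Record steinberg_map (W : zmodType) (f : F -> F -> W) := SteinbergMap {
  smMl x x' y : x != 0 -> x' != 0 -> f (x * x') y = f x y + f x' y;
  smMr x y y' : y != 0 -> y' != 0 -> f x (y * y') = f x y + f x y';
  smS x y : x != 0 -> y != 0 -> x + y = 1 -> f x y = 0;
  sm2 x y : f x y + f x y = 0 }.

Section Steinberg.
Variables (W : zmodType) (f : F -> F -> W) (hf : steinberg_map f).
Implicit Types x y z : F.

Lemma sm1l y : f 1 y = 0.
Proof.
have := smMl hf y (oner_neq0 F) (oner_neq0 F).
by rewrite mulr1 => /eqP; rewrite -{1}[f 1 y]addr0 (inj_eq (addrI _)) => /eqP.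
Qed.

Lemma sm1r x : f x 1 = 0.
Proof.
have := smMr hf x (oner_neq0 F) (oner_neq0 F).
by rewrite mulr1 => /eqP; rewrite -{1}[f x 1]addr0 (inj_eq (addrI _)) => /eqP.
Qed.

Lemma sm_sqrl x y : x != 0 -> f (x ^+ 2) y = 0.
Proof. by move=> x0; rewrite expr2 smMl // sm2. Qed.

Lemma sm_sqrr x y : y != 0 -> f x (y ^+ 2) = 0.
Proof. by move=> x0; rewrite expr2 smMr // sm2. Qed.

Lemma smN x y : - f x y = f x y.
Proof. by apply/esym/eqP; rewrite -addr_eq0 sm2. Qed.

Lemma smVl x y : x != 0 -> f x^-1 y = f x y.
Proof.
move=> x0; apply/eqP; rewrite -[f x y]smN -addr_eq0 -smMl ?invr_eq0 //.
by rewrite mulVf // sm1l.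
Qed.

Lemma smVr x y : y != 0 -> f x y^-1 = f x y.
Proof.
move=> x0; apply/eqP; rewrite -[f x y]smN -addr_eq0 -smMr ?invr_eq0 //.
by rewrite mulVf // sm1r.
Qed.

Lemma sm_add1 x : x != 0 -> 1 + x != 0 -> f x (1 + x) = 0.
Proof.
by move=> x0 x1; apply: (smS hf) => //; rewrite addrCA addrr_pchar2 ?addr0.
Qed.

(** Use the Steinberg relation at 1/x: since 1 + 1/x = (1 + x)/x, it reads f(x, 1 + x) + f(x, x) =
    0, and the first term vanishes. *)
Lemma smxx x : x != 0 -> f x x = 0.
Proof.
move=> x0; have [->|x1] := eqVneq x 1; first exact: sm1l.
have d0 : 1 + x != 0 by rewrite addrC addr_eq0 oppr_pchar2.
have := @sm_add1 x^-1; rewrite invr_eq0 x0.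
have -> : 1 + x^-1 = (1 + x) * x^-1 by field.
rewrite mulf_neq0 ?invr_eq0 // => /(_ isT isT).
by rewrite smMr ?invr_eq0 // smVl // smVr // smVl // sm_add1 // add0r.
Qed.

Lemma smC x y : x != 0 -> y != 0 -> f x y = f y x.
Proof.
move=> x0 y0; have := smxx (mulf_neq0 x0 y0).
rewrite smMl // !smMr // !smxx // add0r addr0 => /eqP.
by rewrite addr_eq0 smN => /eqP.
Qed.

(** Expansion of the Steinberg relation at y/x, where 1 + y/x = (x + y)/x. *)
Lemma sm_addl x y : x != 0 -> y != 0 -> x + y != 0 -> f x y = f (x + y) (x * y).
Proof.
move=> x0 y0 s0.
have := @sm_add1 (y / x); rewrite mulf_neq0 ?invr_eq0 // => /(_ isT).
have -> : 1 + y / x = (x + y) / x by field.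
rewrite mulf_neq0 ?invr_eq0 // => /(_ isT).
rewrite smMl ?invr_eq0 // !smMr ?invr_eq0 // !smVl // !smVr // smxx // addr0 => h.
rewrite (smC x0 y0) !(smC s0) // -[f y x]smN; apply/esym/eqP.
by rewrite -addr_eq0 -addrA addrC h.
Qed.

(** Write x = u (1 + g) with g = v c / u, so that c = g (u/v). The Steinberg relation kills f(g, 1 +
    g), and every other term has an entry in E. *)
Lemma sm_adjoin (E : F -> Prop) c x : subfield2 E ->
  (forall e y, E e -> e != 0 -> f e y = 0) -> c != 0 -> x != 0 ->
  adjoin E c x -> f c x = 0.
Proof.
move=> hE f0 c0 x0 [u [v [Eu Ev def_x]]].
have [v0|v0] := eqVneq v 0.
  by move: x0; rewrite def_x v0 mul0r addr0 => u0; rewrite smC // f0.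
have [u0|u0] := eqVneq u 0.
  by rewrite def_x u0 add0r smMr // smxx // smC // f0 // addr0.
set g := v * c / u; have g0 : g != 0 by rewrite !mulf_neq0 ?invr_eq0.
have defx : x = u * (1 + g) by rewrite def_x /g; field.
have g1 : 1 + g != 0 by move: x0; rewrite defx mulf_eq0 negb_or => /andP[].
rewrite defx smMr // smC // f0 // add0r.
have -> : c = g * (u / v) by rewrite /g; field; rewrite u0 v0.
rewrite smMl ?mulf_neq0 ?invr_eq0 // sm_add1 // f0 ?addr0 //.
  exact: subfield2_div.
by rewrite mulf_neq0 ?invr_eq0.
Qed.

End Steinberg.

(** * Symbols of K_2(F)/2 and K_4(F)/2 as functions of field elements *)

Definition unit_of (x : F) : units F := insubd (uone F) x.

Lemma unit_ofK x : x != 0 -> uval (unit_of x) = x.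
Proof. by move=> x0; rewrite /unit_of insubdK. Qed.

Lemma unit_of_val (x : units F) : unit_of (uval x) = x.
Proof. by apply: val_inj; apply: unit_ofK (uvalP x). Qed.

Lemma unit_ofM x y : x != 0 -> y != 0 -> unit_of (x * y) = (unit_of x * unit_of y)%g.
Proof.
by move=> x0 y0; apply: val_inj; rewrite /= !unit_ofK ?mulf_neq0.
Qed.

(** Total on F so that entries can be computed in the field; [unit_of] reads a zero entry as 1,
    hence the nonvanishing hypotheses below. *)
Definition K2 (x y : F) : milnorKmod 2 F 2 := ksym_mod 2 [tuple unit_of x; unit_of y].

Lemma K2_steinberg : steinberg_map K2.
Proof.
split=> [x x' y x0 x'0|x y y' y0 y'0|x y x0 y0 xy1|x y].
- rewrite /K2 unit_ofM // -(tset20 1%g) ksym_modM.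
  by rewrite !tset20.
- rewrite /K2 unit_ofM // -(tset21 _ 1%g) ksym_modM.
  by rewrite !tset21.
- apply: (@ksym_mod_steinberg _ _ _ _ ord0 ord_max) => //.
  by rewrite !(tnth_nth 1%g) /= !unit_ofK.
- by rewrite -mulr2n milnorKmod_mulrn.
Qed.

Definition K4 (x y z t : F) : milnorKmod 4 F 2 :=
  ksym_mod 2 [tuple unit_of x; unit_of y; unit_of z; unit_of t].

Lemma tset40 (a b c d e : units F) :
  tset [tuple a; b; c; d] (@Ordinal 4 0 isT) e = [tuple e; b; c; d].
Proof. by apply: eq_from_tnth => -[[|[|[|[|]]]]] //= p; rewrite tnth_mktuple. Qed.
Lemma tset41 (a b c d e : units F) :
  tset [tuple a; b; c; d] (@Ordinal 4 1 isT) e = [tuple a; e; c; d].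
Proof. by apply: eq_from_tnth => -[[|[|[|[|]]]]] //= p; rewrite tnth_mktuple. Qed.
Lemma tset42 (a b c d e : units F) :
  tset [tuple a; b; c; d] (@Ordinal 4 2 isT) e = [tuple a; b; e; d].
Proof. by apply: eq_from_tnth => -[[|[|[|[|]]]]] //= p; rewrite tnth_mktuple. Qed.
Lemma tset43 (a b c d e : units F) :
  tset [tuple a; b; c; d] (@Ordinal 4 3 isT) e = [tuple a; b; c; e].
Proof. by apply: eq_from_tnth => -[[|[|[|[|]]]]] //= p; rewrite tnth_mktuple. Qed.

Lemma K4M0 x x' y z t : x != 0 -> x' != 0 -> K4 (x * x') y z t = K4 x y z t + K4 x' y z t.
Proof. by move=> *; rewrite /K4 unit_ofM // -(tset40 1%g) ksym_modM !tset40. Qed.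
Lemma K4M1 x x' y z t : x != 0 -> x' != 0 -> K4 y (x * x') z t = K4 y x z t + K4 y x' z t.
Proof. by move=> *; rewrite /K4 unit_ofM // -(tset41 _ 1%g) ksym_modM !tset41. Qed.
Lemma K4M2 x x' y z t : x != 0 -> x' != 0 -> K4 y z (x * x') t = K4 y z x t + K4 y z x' t.
Proof. by move=> *; rewrite /K4 unit_ofM // -(tset42 _ _ 1%g) ksym_modM !tset42. Qed.
Lemma K4M3 x x' y z t : x != 0 -> x' != 0 -> K4 y z t (x * x') = K4 y z t x + K4 y z t x'.
Proof. by move=> *; rewrite /K4 unit_ofM // -(tset43 _ _ _ 1%g) ksym_modM !tset43. Qed.

Lemma K4_2 x y z t : K4 x y z t + K4 x y z t = 0.
Proof. by rewrite -mulr2n milnorKmod_mulrn. Qed.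

Lemma K4_steinberg01 z t : steinberg_map (fun x y => K4 x y z t).
Proof.
split=> [*|*|x y x0 y0 xy1|*]; rewrite ?K4M0 ?K4M1 ?K4_2 //.
apply: (@ksym_mod_steinberg _ _ _ _ (@Ordinal 4 0 isT) (@Ordinal 4 1 isT)) => //.
by rewrite !(tnth_nth 1%g) /= !unit_ofK.
Qed.
Lemma K4_steinberg12 z t : steinberg_map (fun x y => K4 z x y t).
Proof.
split=> [*|*|x y x0 y0 xy1|*]; rewrite ?K4M1 ?K4M2 ?K4_2 //.
apply: (@ksym_mod_steinberg _ _ _ _ (@Ordinal 4 1 isT) (@Ordinal 4 2 isT)) => //.
by rewrite !(tnth_nth 1%g) /= !unit_ofK.
Qed.
Lemma K4_steinberg23 z t : steinberg_map (fun x y => K4 z t x y).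
Proof.
split=> [*|*|x y x0 y0 xy1|*]; rewrite ?K4M2 ?K4M3 ?K4_2 //.
apply: (@ksym_mod_steinberg _ _ _ _ (@Ordinal 4 2 isT) (@Ordinal 4 3 isT)) => //.
by rewrite !(tnth_nth 1%g) /= !unit_ofK.
Qed.

(** Asymmetric: it is the last argument that lies in the field generated over F^2 by the others. *)
Definition dependent (a b c d : F) := adjoin (adjoin (adjoin squares a) b) c d.

Lemma K4_rot a b c d : a != 0 -> b != 0 -> c != 0 -> d != 0 ->
  K4 a b c d = K4 b c d a.
Proof.
move=> a0 b0 c0 d0; rewrite (smC (K4_steinberg01 c d)) //.
by rewrite (smC (K4_steinberg12 b d)) // (smC (K4_steinberg23 b c)).
Qed.

(** Descent along F^2(a,b,c), F^2(a,b), F^2(a), F^2: at each level [sm_adjoin], applied to two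
    adjacent slots, reduces to the level below, and squares vanish modulo 2. *)
Lemma K4_dependent a b c d : a != 0 -> b != 0 -> c != 0 -> d != 0 ->
  dependent a b c d -> K4 a b c d = 0.
Proof.
move=> a0 b0 c0 d0.
have hsq := subfield2_squares.
have ha := subfield2_adjoin hsq a; have hb := subfield2_adjoin ha b.
have K1 e z t : adjoin squares a e -> e != 0 -> K4 a e z t = 0.
  move=> Ee e0; apply: (sm_adjoin (K4_steinberg01 z t) hsq _ a0 e0 Ee).
  move=> _ y [x ->]; rewrite sqrf_eq0 => x0.
  exact: (sm_sqrl (K4_steinberg01 z t)).
have K2' e t : adjoin (adjoin squares a) b e -> e != 0 -> K4 a b e t = 0.
  move=> Ee e0; apply: (sm_adjoin (K4_steinberg12 a t) ha _ b0 e0 Ee) => *.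
  exact: K1.
move=> Ed; apply: (sm_adjoin (K4_steinberg23 a b) hb _ c0 d0 Ed) => *.
exact: K2'.
Qed.

End Char2.

(** * Dependent slots: the sum becomes a single symbol modulo 4 *)

Section Linkage.
Variables (F : fieldType) (charF : 2%N \in [pchar F]).
Implicit Types a b c d p q r s t x y z : F.
Local Notation K2 := (@K2 F).
Local Notation squares := (@squares F).
Let hf : steinberg_map K2 := K2_steinberg F.
Let hsq : subfield2 squares := subfield2_squares charF.

Definition K2mod4 x y : milnorKmod 2 F 4 := ksym_mod 4 [tuple unit_of x; unit_of y].

Lemma K2mod4Ml x x' y : x != 0 -> x' != 0 ->
  K2mod4 (x * x') y = K2mod4 x y + K2mod4 x' y.
Proof.
by move=> *; rewrite /K2mod4 unit_ofM // -(tset20 1%g) ksym_modM !tset20.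
Qed.

Lemma K2mod4Mr x y y' : y != 0 -> y' != 0 ->
  K2mod4 x (y * y') = K2mod4 x y + K2mod4 x y'.
Proof.
by move=> *; rewrite /K2mod4 unit_ofM // -(tset21 _ 1%g) ksym_modM !tset21.
Qed.

Lemma K2mod4_add1 x : x != 0 -> 1 + x != 0 -> K2mod4 x (1 + x) = 0.
Proof.
move=> x0 x1; apply: (@ksym_mod_steinberg _ _ _ _ ord0 ord_max) => //.
by rewrite !(tnth_nth 1%g) /= !unit_ofK // addrCA addrr_pchar2 ?addr0.
Qed.

Lemma K2_emb_K2 x y : K2_emb (K2 x y) = K2mod4 x y *+ 2.
Proof.
rewrite K2_embE expgS expg1 -(tset21 _ 1%g) ksym_modM !tset21.
by rewrite mulr2n.
Qed.

Definition mod4_symbol (u : milnorKmod 2 F 2) :=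
  exists alpha beta : units F, K2_emb u = ksym_mod 4 [tuple alpha; beta].

Lemma mod4_symbol_K2 x y : mod4_symbol (K2 x y).
Proof. by exists (unit_of x), (unit_of y ^+ 2)%g; rewrite K2_embE. Qed.

(** The symbol {g z^2, x^2 (1+g)}_4 expands to 2{g,x} + 2{z,1+g} + 4{z,x} + {g,1+g}, and the last
    two terms vanish. *)
Lemma mod4_symbol_add1 g x z : g != 0 -> 1 + g != 0 -> x != 0 -> z != 0 ->
  mod4_symbol (K2 g x + K2 (1 + g) z).
Proof.
move=> g0 g1 x0 z0; exists (unit_of (g * (z * z))), (unit_of (x * x * (1 + g))).
rewrite (smC charF hf g1 z0) // raddfD /= !K2_emb_K2 -[RHS]/(K2mod4 _ _).
rewrite !K2mod4Mr ?mulf_neq0 // !K2mod4Ml ?mulf_neq0 // K2mod4_add1 // add0r.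
rewrite -!mulr2n mulrnDl -mulrnA -[X in _ = _ + X + _]/(_ *+ 4).
by rewrite milnorKmod_mulrn addr0.
Qed.

Lemma K2_sqr0l r x : squares r -> r != 0 -> K2 r x = 0.
Proof. by case=> y ->; rewrite sqrf_eq0 => y0; rewrite (sm_sqrl hf). Qed.

Lemma K2_sqrl r x y : squares r -> r != 0 -> x != 0 -> K2 (r * x) y = K2 x y.
Proof. by move=> sr r0 x0; rewrite (smMl hf) // K2_sqr0l // add0r. Qed.

Lemma K2_sqr0r r x : squares r -> r != 0 -> K2 x r = 0.
Proof. by case=> y ->; rewrite sqrf_eq0 => y0; rewrite (sm_sqrr hf). Qed.

Lemma K2_sqrr r x y : squares r -> r != 0 -> y != 0 -> K2 x (r * y) = K2 x y.
Proof. by move=> sr r0 x0; rewrite (smMr hf) // K2_sqr0r // add0r. Qed.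

Lemma K2_adjoin a n : a != 0 -> n != 0 -> adjoin squares a n -> K2 a n = 0.
Proof.
by move=> a0 n0; apply: (sm_adjoin charF hf hsq) => // e y *; apply: K2_sqr0l.
Qed.

(** This is [sm_addl] for r x and y, with the square r dropped from the entries where it is a
    factor. It moves a symbol to a prescribed first slot. *)
Lemma K2_slot r x y : squares r -> x != 0 -> y != 0 -> r * x + y != 0 ->
  K2 x y = K2 (r * x + y) (x * y).
Proof.
move=> sr x0 y0; have [->|r0] := eqVneq r 0.
  rewrite mul0r add0r => _.
  by rewrite (smMr hf) // (smxx charF hf) // addr0 (smC charF hf).
move=> s0; rewrite -(K2_sqrl _ sr) // (sm_addl charF hf) ?mulf_neq0 //.
by rewrite -mulrA (K2_sqrr _ sr) ?mulf_neq0.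
Qed.

(** Dividing the relation by the square s turns the first slots into g = (r/s) e1 and 1 + g. If r or
    s is 0, the sum collapses to one symbol already in K_2(F)/2. *)
Lemma mod4_symbol_linked e1 e2 x z r s : squares r -> squares s ->
  e1 != 0 -> e2 != 0 -> x != 0 -> z != 0 -> e2 = r * e1 + s ->
  mod4_symbol (K2 e1 x + K2 e2 z).
Proof.
move=> sr ss e10 e20 x0 z0 def_e2.
have [r0|r0] := eqVneq r 0.
  have -> : e2 = s by rewrite def_e2 r0 mul0r add0r.
  rewrite (@K2_sqr0l s) // ?addr0; first exact: mod4_symbol_K2.
  by move: e20; rewrite def_e2 r0 mul0r add0r.
have [s0|s0] := eqVneq s 0.
  rewrite def_e2 s0 addr0 (K2_sqrl _ sr r0 e10) -(smMr hf) //.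
  exact: mod4_symbol_K2.
have sM : squares s^-1 by exact: subfield2V.
have sD : squares (r / s) by exact: subfield2_div.
rewrite -(K2_sqrl _ sD _ e10) ?mulf_neq0 ?invr_eq0 //.
rewrite -(K2_sqrl _ sM _ e20) ?invr_eq0 //.
have def_s : s^-1 * e2 = 1 + r / s * e1 by rewrite def_e2; field.
have := mulf_neq0 (invr_neq0 s0) e20; rewrite def_s => g0.
by apply: mod4_symbol_add1 => //; rewrite !mulf_neq0 ?invr_eq0.
Qed.

(** The values of the pure part <a, b, ab> of the bilinear Pfister form attached to {a,b}. *)
Definition pure a b y :=
  exists r s t, [/\ squares r, squares s, squares t & y = r * a + s * b + t * (a * b)].

Lemma pureD a b y z : pure a b y -> pure a b z -> pure a b (y + z).
Proof.
have [hD hM _] := hsq.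
move=> [r [s [t [hr hs ht ->]]]] [r' [s' [t' [hr' hs' ht' ->]]]].
exists (r + r'), (s + s'), (t + t'); split; [exact: (hD)|exact: (hD)|exact: (hD)|].
by ring.
Qed.

Lemma pureZ a b e y : squares e -> pure a b y -> pure a b (e * y).
Proof.
have [hD hM _] := hsq.
move=> he [r [s [t [hr hs ht ->]]]].
exists (e * r), (e * s), (e * t); split; [exact: (hM)|exact: (hM)|exact: (hM)|].
by ring.
Qed.

Lemma pureS a b a' b' y : pure a' b' a -> pure a' b' b -> pure a' b' (a * b) ->
  pure a b y -> pure a' b' y.
Proof.
move=> ha hb hab [r [s [t [hr hs ht ->]]]].
by apply: pureD; [apply: pureD|]; apply: pureZ.
Qed.

Let sq0 : squares 0. Proof. exact: subfield2_0 hsq. Qed.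
Let sq1 : squares 1. Proof. exact: subfield2_1 hsq. Qed.
Let sqX x : squares (x ^+ 2). Proof. by exists x. Qed.
Let sqM x y : squares x -> squares y -> squares (x * y).
Proof. by case: hsq => _ + _; apply. Qed.
Let sqD x y : squares x -> squares y -> squares (x + y).
Proof. by case: hsq => + _ _; apply. Qed.
Let sqV x y : squares x -> squares y -> squares (x / y).
Proof. exact: subfield2_div. Qed.

Lemma pure_gen1 a b : pure a b a.
Proof. by exists 1, 0, 0; split=> //; ring. Qed.
Lemma pure_gen2 a b : pure a b b.
Proof. by exists 0, 1, 0; split=> //; ring. Qed.
Lemma pure_gen3 a b : pure a b (a * b).
Proof. by exists 0, 0, 1; split=> //; ring. Qed.

(** Put n = s + t a. It lies in F^2(a), so {a,n} = 0. Since 1/n = n/n^2, one has b = (s/n^2)(b n) +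
    (t/n^2)(a b n), and similarly for a b; so pure elements remain pure. *)
Lemma pure_slot_norm a b s t : a != 0 -> b != 0 -> squares s -> squares t ->
  s + t * a != 0 -> K2 a b = K2 a (b * (s + t * a)) /\
  (forall p, pure a b p -> pure a (b * (s + t * a)) p).
Proof.
move=> a0 b0 hs ht n0; split.
  by rewrite (smMr hf) // (@K2_adjoin a (s + t * a)) // ?addr0 //; exists s, t.
move=> p; apply: pureS; first exact: pure_gen1.
  exists 0, (s / (s + t * a) ^+ 2), (t / (s + t * a) ^+ 2).
  by split=> //; [exact: sqV|exact: sqV|field].
exists 0, (t * a ^+ 2 / (s + t * a) ^+ 2), (s / (s + t * a) ^+ 2).
by split=> //; [apply: sqV => //; exact: sqM|exact: sqV|field].
Qed.

(** Analogue of the pure subform theorem. With n = s + t a one has y = r a + b n: first b is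
    replaced by b n, then [K2_slot] brings y into the first slot. *)
Lemma pure_slot a b y : a != 0 -> b != 0 -> y != 0 -> pure a b y ->
  exists2 x, x != 0 & K2 a b = K2 y x /\ (forall p, pure a b p -> pure y x p).
Proof.
move=> a0 b0 + [r [s [t [hr hs ht def_y]]]].
have {def_y} -> : y = r * a + b * (s + t * a) by rewrite def_y; ring.
have [n0|n0] := eqVneq (s + t * a) 0.
  rewrite n0 mulr0 addr0 mulf_eq0 negb_or => /andP[r0 _].
  exists b => //; split; first by rewrite K2_sqrl.
  have ha z : a * z = 1 / r * (r * a * z) by field.
  move=> p; apply: pureS; [|exact: pure_gen2|].
    by rewrite -[X in pure _ _ X]mulr1 ha mulr1; apply: pureZ (pure_gen1 _ _); exact: sqV.
  by rewrite ha; apply: pureZ (pure_gen3 _ _); exact: sqV.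
have [-> pS] := pure_slot_norm a0 b0 hs ht n0.
move: (b * _) (mulf_neq0 b0 n0) pS => {hs ht n0 b0 s t}b' b0 pS y0.
have [r0|r0] := eqVneq r 0.
  rewrite r0 mul0r add0r; exists a => //; split; first exact: (smC charF hf).
  move=> p /pS; apply: pureS; [exact: pure_gen2|exact: pure_gen1|].
  by rewrite mulrC; apply: pure_gen3.
exists (a * b'); first exact: mulf_neq0.
split; first by rewrite -K2_slot.
move=> p /pS; apply: pureS; last exact: pure_gen2.
  (* With y = r a + b' and 1/y = y/y^2, these are the coefficients of a = (r a^2 + a b')/y; the next
     ones are those of b' = (b'^2 + r a b')/y. *)
  exists (r * a ^+ 2 / (r * a + b') ^+ 2), 0, (1 / (r * a + b') ^+ 2).
  by split=> //; [apply: sqV => //; exact: sqM|exact: sqV|field].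
exists (b' ^+ 2 / (r * a + b') ^+ 2), 0, (r / (r * a + b') ^+ 2).
by split=> //; [exact: sqV|exact: sqV|field].
Qed.

(** Adding a term twice turns an identity of characteristic 2 into one valid in every commutative
    ring. *)
Let add2 x y : x + y + y = x. Proof. by rewrite -addrA addrr_pchar2 ?addr0. Qed.

(* The linking slots [p0 p' + abd] and [c p' + al a^2 d], where
   [p' = al a + b], were found as the w in F^2(a,b,d) with dw killing
   dlog a dlog b + dlog c dlog d. *)
Lemma mod4_symbol_normal_form a b c d p0 al : a != 0 -> b != 0 -> c != 0 -> d != 0 ->
  squares p0 -> squares al -> c = p0 + al * a + b + a * d ->
  mod4_symbol (K2 a b + K2 c d).
Proof.
move=> a0 b0 c0 d0 hp0 hal def_c.
have [p0'|pn0] := eqVneq (al * a + b) 0.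
  have def_b : b = al * a by apply/eqP; rewrite -subr_eq0 oppr_pchar2 // addrC p0'.
  have al0 : al != 0 by move: b0; rewrite def_b mulf_eq0 negb_or => /andP[].
  rewrite def_b K2_sqrr // (smxx charF hf) // add0r; exact: mod4_symbol_K2.
rewrite (K2_slot hal a0 b0 pn0); move: pn0; set p := al * a + b => pn0.
(* Two copies of {p,d} are added; they cancel. *)
have -> : K2 p (a * b) + K2 c d = K2 p (a * b * d) + K2 (c * p) d.
  rewrite [in RHS](smMr hf) ?mulf_neq0 // [in RHS](smMl hf) //.
  by rewrite addrACA (sm2 hf) addr0.
set w1 := p0 * p + a * b * d; set w2 := al * a ^+ 2 * d + c * p.
have w12 : w2 = 1 * w1 + p ^+ 2.
  rewrite -[RHS](add2 _ (al * a ^+ 2 * d)) /w2 /w1 def_c /p; ring.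
have [w10|w10] := eqVneq w1 0.
  have e : a * b * d = p0 * p.
    by apply/eqP; rewrite -subr_eq0 oppr_pchar2 // addrC -/w1 w10.
  have p00 : p0 != 0.
    have : a * b * d != 0 by rewrite !mulf_neq0.
    by rewrite e mulf_eq0 negb_or => /andP[].
  rewrite e K2_sqrr // (smxx charF hf) // add0r; exact: mod4_symbol_K2.
have hala : squares (al * a ^+ 2) by exact: sqM.
have [w20|w20] := eqVneq w2 0.
  have e : c * p = al * a ^+ 2 * d.
    by apply/eqP; rewrite -subr_eq0 oppr_pchar2 // addrC -/w2 w20.
  have al0 : al * a ^+ 2 != 0.
    have : c * p != 0 by rewrite mulf_neq0.
    by rewrite e mulf_eq0 negb_or => /andP[].
  rewrite e K2_sqrl // (smxx charF hf) // addr0; exact: mod4_symbol_K2.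
rewrite (K2_slot hp0 pn0 _ w10) ?mulf_neq0 //.
rewrite (smC charF hf (mulf_neq0 c0 pn0) d0).
rewrite (K2_slot hala d0 _ w20) ?mulf_neq0 //.
by apply: mod4_symbol_linked w12; rewrite ?mulf_neq0.
Qed.

(** If q = 0, a nonzero p becomes a slot of {a,b} and is linked to c = p0 + p. Otherwise q becomes
    the first slot and p = al q + x (s + t q); absorbing s + t q into x gives the normal form. *)
Lemma mod4_symbol_pure a b c d p0 p q : a != 0 -> b != 0 -> c != 0 -> d != 0 ->
  squares p0 -> pure a b p -> pure a b q -> c = p0 + p + q * d ->
  mod4_symbol (K2 a b + K2 c d).
Proof.
move=> a0 b0 c0 d0 hp0 hp hq def_c.
have [q0|q0] := eqVneq q 0.
  move: def_c; rewrite q0 mul0r addr0 => def_c.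
  have [p'0|p'0] := eqVneq p 0.
    rewrite (@K2_sqr0l c) ?addr0; first exact: mod4_symbol_K2.
      by rewrite def_c p'0 addr0.
    exact: c0.
  have [x x0 [-> _]] := pure_slot a0 b0 p'0 hp.
  by apply: (@mod4_symbol_linked _ _ _ _ 1 p0) => //; rewrite def_c mul1r addrC.
have [x x0 [-> /(_ _ hp)]] := pure_slot a0 b0 q0 hq.
move=> [al [s [t [hal hs ht def_p]]]] {a b a0 b0 hp hq}.
have {def_p} def_p : p = al * q + x * (s + t * q) by rewrite def_p; ring.
have [n0|n0] := eqVneq (s + t * q) 0; last first.
  have [-> _] := pure_slot_norm q0 x0 hs ht n0.
  apply: (mod4_symbol_normal_form (p0 := p0) (al := al)) => //.
    by rewrite mulf_neq0.
  by rewrite def_c def_p addrA.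
move: def_p; rewrite n0 mulr0 addr0 => def_p.
(* Now p = al q. After two copies of {q,d} are added, the second symbol gets the slot q^2 d + q c =
   p0 q + al q^2, which is linked to q. *)
have -> : K2 q x + K2 c d = K2 q (x * d) + K2 (q * c) d.
  rewrite (smMr hf) // (smMl hf) // -addrA; congr (_ + _).
  by rewrite addrA (sm2 hf) add0r.
have [w0|w0] := eqVneq (q ^+ 2 * d + q * c) 0.
  have -> : q * c = q ^+ 2 * d.
    by apply/eqP; rewrite -subr_eq0 oppr_pchar2 // addrC w0.
  rewrite K2_sqrl // ?sqrf_eq0 // (smxx charF hf) // addr0; exact: mod4_symbol_K2.
rewrite (smC charF hf (mulf_neq0 q0 c0) d0).
rewrite (K2_slot (sqX q) d0 _ w0) ?mulf_neq0 //.
apply: (@mod4_symbol_linked _ _ _ _ p0 (al * q ^+ 2)) => //.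
- exact: sqM.
- by rewrite mulf_neq0.
- by rewrite !mulf_neq0.
by rewrite -[RHS](add2 _ (q ^+ 2 * d)) def_c def_p; ring.
Qed.

(** Write c = (p0 + p) + (q0 + q) d with p, q pure. The factor N = p0 + q0 d lies in F^2(d), so {cN,
    d} = {c,d}, and in cN the coefficient of d is pure. If N = 0 and q0 is nonzero, then d is a
    square. *)
Lemma mod4_symbol_dependent a b c d : a != 0 -> b != 0 -> c != 0 -> d != 0 ->
  dependent a b d c -> mod4_symbol (K2 a b + K2 c d).
Proof.
move=> a0 b0 c0 d0.
have pure_of y : adjoin (adjoin squares a) b y ->
    exists y0 y', [/\ squares y0, pure a b y' & y = y0 + y'].
  move=> [_ [_ [[u [v [hu hv ->]]] [s [t [hs ht ->]]] ->]]].
  exists u, (v * a + s * b + t * (a * b)).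
  by split=> //; [exists v, s, t|ring].
move=> [_ [_ [/pure_of[p0 [p [hp0 hp ->]]] /pure_of[q0 [q [hq0 hq ->]]] def_c]]].
have [z0|z0] := eqVneq q0 0.
  by apply: (mod4_symbol_pure (p0 := p0) (p := p) (q := q)); rewrite // def_c z0 add0r.
have [N0|N0] := eqVneq (p0 + q0 * d) 0.
  have -> : d = - p0 / q0.
    apply: (mulIf z0); rewrite divfK //; apply/eqP.
    by rewrite eq_sym mulrC eqr_oppLR -addr_eq0 N0.
  rewrite oppr_pchar2 // (@K2_sqr0r (p0 / q0)) ?addr0; first exact: mod4_symbol_K2.
    exact: sqV.
  apply: contra_neq d0; move/eqP: N0; rewrite addr_eq0 => /eqP -> /eqP.
  by rewrite mulNr oppr_eq0 mulrAC mulfV // mul1r => /eqP.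
have -> : K2 c d = K2 (c * (p0 + q0 * d)) d.
  rewrite (smMl hf) // (smC charF hf N0) // (@K2_adjoin d) ?addr0 //.
  by exists p0, q0.
apply: (mod4_symbol_pure (p0 := p0 ^+ 2 + (q0 * d) ^+ 2)
  (p := p0 * p + q0 * d ^+ 2 * q) (q := p0 * q + q0 * p)) => //.
- by rewrite mulf_neq0.
- exact: sqD.
- by apply: pureD; apply: pureZ => //; exact: sqM.
- by apply: pureD; apply: pureZ.
rewrite -[RHS](add2 _ (p0 * q0 * d)) def_c; ring.
Qed.

End Linkage.

(** * Commuting derivations dual to an independent family *)

Section Derivations.
Variables (F : fieldType) (charF : 2%N \in [pchar F]).
Implicit Types (A : set F) (x y : F).
Local Open Scope classical_set_scope.

(** The field F^2(A), encoded by its universal property so that membership serves directly as an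
    induction principle. *)
Definition generated2 A y :=
  forall E : F -> Prop, subfield2 E -> (forall x, A x -> E x) -> E y.

Lemma sub_generated2 A y : A y -> generated2 A y.
Proof. by move=> Ay E _; apply. Qed.

Lemma subfield2_generated2 A : subfield2 (generated2 A).
Proof.
split=> [x y hx hy|x y hx hy|x] E hE hA; have [hD hM hX] := hE; last exact: hX.
  by apply: hD; [exact: hx|exact: hy].
by apply: hM; [exact: hx|exact: hy].
Qed.

Lemma generated2S A B y : A `<=` B -> generated2 A y -> generated2 B y.
Proof. by move=> AB hy E hE hB; apply: hy => // x /AB; apply: hB. Qed.

Lemma generated2U1 A x y : generated2 (A `|` [set x]) y -> adjoin (generated2 A) x y.
Proof.
have hA := subfield2_generated2 A; apply; first exact: subfield2_adjoin.
move=> z [Az|->]; last exact: mem_adjoin.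
by apply: sub_adjoin => //; exact: sub_generated2.
Qed.

(* The disjunct [generated2 B y] only matters when the chain is empty. *)
Lemma generated2_bigcup (C : set (set F)) B y : total_on C subset ->
  generated2 (\bigcup_(A in C) A `|` B) y ->
  generated2 B y \/ exists2 A, C A & generated2 (A `|` B) y.
Proof.
move=> totC; pose H y := generated2 B y \/ exists2 A, C A & generated2 (A `|` B) y.
have dir x z : H x -> H z ->
    exists2 A, (forall w, generated2 A w -> H w) & generated2 A x /\ generated2 A z.
  have BS A : generated2 B `<=` generated2 (A `|` B).
    by move=> w; apply: generated2S; exact: subsetUr.
  case=> [hx|[A CA hx]] [hz|[A' CA' hz]].
  - by exists B => // w hw; left.
  - by exists (A' `|` B); [move=> w hw; right; exists A'|split=> //; exact: BS].
  - by exists (A `|` B); [move=> w hw; right; exists A|split=> //; exact: BS].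
  have [AA'|A'A] := totC _ _ CA CA'.
    exists (A' `|` B); first by move=> w hw; right; exists A'.
    by split=> //; apply: generated2S hx; exact: setSU.
  exists (A `|` B); first by move=> w hw; right; exists A.
  by split=> //; apply: generated2S hz; exact: setSU.
move=> /(_ H); apply.
  split=> [x z hx hz|x z hx hz|x].
  - have [A HA [Ax Az]] := dir x z hx hz; apply: HA.
    by have [hD _ _] := subfield2_generated2 A; exact: hD.
  - have [A HA [Ax Az]] := dir x z hx hz; apply: HA.
    by have [_ hM _] := subfield2_generated2 A; exact: hM.
  - by left; have [_ _ hX] := subfield2_generated2 B; exact: hX.
move=> x [[A CA Ax]|Bx]; last by left; exact: sub_generated2.
by right; exists A => //; apply: sub_generated2; left.
Qed.

Record derivation (D : F -> F) := Derivation {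
  derD x y : D (x + y) = D x + D y;
  derM x y : D (x * y) = D x * y + x * D y }.

Section DerivationTheory.
Variables (D : F -> F) (hD : derivation D).

Lemma der0 : D 0 = 0.
Proof.
have := derD hD 0 0; rewrite addr0 => /eqP.
by rewrite -{1}[D 0]addr0 (inj_eq (addrI _)) => /eqP.
Qed.

Lemma der_sqr x : D (x ^+ 2) = 0.
Proof. by rewrite expr2 derM // mulrC addrr_pchar2. Qed.

Lemma der1 : D 1 = 0.
Proof. by rewrite -(expr1n _ 2) der_sqr. Qed.

Lemma derN x : D (- x) = - D x.
Proof. by rewrite !oppr_pchar2. Qed.

Lemma derB x y : D (x - y) = D x - D y.
Proof. by rewrite derD // derN. Qed.

Lemma derV x : x != 0 -> D x^-1 = - D x / x ^+ 2.
Proof.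
move=> x0; apply: (mulfI x0); apply: (addrI (D x * x^-1)).
rewrite -derM // mulfV // der1; field.
by rewrite x0.
Qed.

End DerivationTheory.

(** F is the direct sum of E and E x, and D sends u + v x to v x: this is x d/dx over E. The Leibniz
    rule uses that x^2 lies in E and 2 = 0. *)
Lemma euler_derivation (E : F -> Prop) x : subfield2 E -> ~ E x ->
  (forall y, adjoin E x y) ->
  exists D, [/\ derivation D, forall y, E y -> D y = 0, D x = x
    & forall y, D (D y) = D y].
Proof.
move=> hE nEx hx; have [hD hM hX] := hE.
have E0 := subfield2_0 hE; have E1 := subfield2_1 hE.
have uniq u v u' v' : E u -> E v -> E u' -> E v' -> u + v * x = u' + v' * x -> v = v'.
  move=> Eu Ev Eu' Ev' e; apply: contrapT => vv'.
  have d0 : v - v' != 0 by rewrite subr_eq0; apply/eqP.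
  apply: nEx; have -> : x = (u' - u) / (v - v').
    apply: (mulIf d0); rewrite divfK // mulrBr ![x * _]mulrC; apply/eqP.
    by rewrite subr_eq addrAC eq_sym subr_eq -e addrC.
  by rewrite !oppr_pchar2 //; apply: subfield2_div => //; exact: hD.
have [D hDE] : exists D : F -> F, forall u v, E u -> E v -> D (u + v * x) = v * x.
  have [f hf] := choice (fun y => hx y).
  have [g hg] := choice hf.
  exists (fun y => g y * x) => u v Eu Ev.
  have [Ef Eg e] := hg (u + v * x); congr (_ * _).
  by apply: (@uniq (f (u + v * x)) _ u).
exists D; split.
- split=> [y z|y z]; have [u [v [Eu Ev ->]]] := hx y; have [s [t [Es Et ->]]] := hx z.
    have -> : u + v * x + (s + t * x) = (u + s) + (v + t) * x by ring.
    by rewrite !hDE //; [ring|exact: hD|exact: hD].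
  have -> : (u + v * x) * (s + t * x) = (u * s + (v * t) * x ^+ 2) + (u * t + v * s) * x.
    by ring.
  rewrite !hDE //; last 2 first.
  - by apply: (hD); apply: (hM) => //; exact: (hM).
  - by apply: (hD); exact: (hM).
  rewrite -[LHS]addr0 -(addrr_pchar2 charF (v * t * x ^+ 2)); ring.
- by move=> y Ey; rewrite -[y]addr0 -(mul0r x) hDE // mul0r.
- by rewrite -{1}[x]add0r -{1}(mul1r x) hDE // mul1r.
move=> y; have [u [v [Eu Ev ->]]] := hx y.
by rewrite hDE // -{1}[v * x]add0r hDE.
Qed.

(** Take A maximal such that no t_i lies in the field generated over F^2 by A and the other t_j.
    Then A and all the t_j generate F, and D_i is the Euler derivation in t_i. *)
Lemma dual_derivations n (t : 'I_n -> F) :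
  (forall i, ~ generated2 [set t j | j in [set j | j != i]] (t i)) ->
  exists D : 'I_n -> F -> F, [/\ forall i, derivation (D i),
    forall i j x, D i (D j x) = D j (D i x), forall i x, D i (D i x) = D i x
    & forall i j, D i (t j) = if i == j then t j else 0].
Proof.
pose others i := [set t j | j in [set j | j != i]]; rewrite -/others => ind.
have [A [indA maxA]] :
    exists A, (forall i, ~ generated2 (A `|` others i) (t i)) /\
      forall B, A `<` B -> ~ forall i, ~ generated2 (B `|` others i) (t i).
  apply: (@Zorn_bigcup F [set A | forall i, ~ generated2 (A `|` others i) (t i)]).
  move=> C sub totC i /(generated2_bigcup totC)[|[A /sub /(_ i)]]; last by [].
  exact: ind.
pose all := range t; pose E i := generated2 (A `|` others i).
have hE i : subfield2 (E i) by exact: subfield2_generated2.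
have genF y : generated2 (A `|` all) y.
  have [Ay|nAy] := pselect (A y); first by apply: sub_generated2; left.
  (* Enlarging A by y destroys independence, so t_i = u + v y for some i; here v is nonzero, and one
     solves for y. *)
  have /existsNP[i /contrapT] :
      ~ forall i, ~ generated2 (A `|` [set y] `|` others i) (t i).
    apply: maxA; split; first exact: subsetUl.
    by move=> /(_ y) h; apply: nAy; apply: h; right.
  rewrite setUAC => /generated2U1[u [v [Eu Ev def_t]]].
  have oa : A `|` others i `<=` A `|` all.
    by apply: setUS => _ [j _ <-]; exists j.
  have [v0|v0] := eqVneq v 0.
    by case: (indA i); rewrite def_t v0 mul0r addr0.
  have h := subfield2_generated2 (A `|` all); have [hD hM _] := h.
  have -> : y = (t i + u) / v.
    by rewrite {1}def_t addrAC addrr_pchar2 // add0r mulrAC mulfV // mul1r.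
  apply: (subfield2_div h); last exact: generated2S Ev.
  apply: hD; last exact: generated2S Eu.
  by apply: sub_generated2; right; exists i.
have adjF i y : adjoin (E i) (t i) y.
  apply: (genF y (adjoin (E i) (t i))); first exact: subfield2_adjoin.
  move=> x [Ax|[j _ <-]].
    by apply: (sub_adjoin (hE i)); apply: sub_generated2; left.
  have [->|ji] := eqVneq j i; first exact: (mem_adjoin (hE i)).
  by apply: (sub_adjoin (hE i)); apply: sub_generated2; right; exists j.
have [D hD] := choice (fun i => euler_derivation (hE i) (indA i) (adjF i)).
have Dt i j : D i (t j) = if i == j then t j else 0.
  have [_ D0 Dt _] := hD i; have [<-//|ij] := eqVneq i j.
  by apply: D0; apply: sub_generated2; right; exists j; rewrite //= eq_sym.
have hder i : derivation (D i) by case: (hD i).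
exists D; split=> // [i j x|i x]; last by case: (hD i).
have [hi Ai _ _] := hD i; have [hj Aj _ _] := hD j.
(* Derivations kill squares, so the elements on which D_i and D_j commute form a subfield containing
   F^2; generators suffice. *)
apply: (genF x (fun x => D i (D j x) = D j (D i x))).
  split=> [y z e e'|y z e e'|y].
  - by rewrite !(derD hi) !(derD hj) !(derD hi) e e'.
  - rewrite !(derM hi) !(derM hj) !(derD hi) !(derD hj) !(derM hi) !(derM hj) e e'.
    by ring.
  - by rewrite (der_sqr hi) (der_sqr hj) (der0 hi) (der0 hj).
move=> y [Ay|[k _ <-]].
  have -> : D i y = 0 by apply: Ai; apply: sub_generated2; left.
  have -> : D j y = 0 by apply: Aj; apply: sub_generated2; left.
  by rewrite (der0 hi) (der0 hj).
rewrite !Dt; case: (eqVneq j k) => [->|jk]; case: (eqVneq i k) => [->|ik] //.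
- by rewrite Dt (negbTE ik) (der0 (hder k)).
- by rewrite Dt (negbTE jk) (der0 (hder k)).
- by rewrite (der0 hi) (der0 hj).
Qed.

End Derivations.

(** * Nonvanishing of symbols by determinants of logarithmic derivatives *)

Section DlogDeterminant.
Variables (F : fieldType) (charF : 2%N \in [pchar F]).

Definition dlog (D : F -> F) (x : F) := D x / x.

Lemma dlogM D x y : derivation D -> x != 0 -> y != 0 ->
  dlog D (x * y) = dlog D x + dlog D y.
Proof. by move=> hD x0 y0; rewrite /dlog derM //; field; rewrite x0 y0. Qed.

Lemma tnth_tset (T : Type) n (t : n.-tuple T) i x j :
  tnth (tset t i x) j = if j == i then x else tnth t j.
Proof. exact: tnth_mktuple. Qed.

Section Determinant.
Variables (n : nat) (D : 'I_n -> F -> F) (hD : forall i, derivation (D i)).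

Definition dlog_mx (t : n.-tuple (units F)) : 'M[F]_n :=
  \matrix_(i, j) dlog (D j) (uval (tnth t i)).

Lemma row'_dlog_mx t i x y :
  row' i (dlog_mx (tset t i x)) = row' i (dlog_mx (tset t i y)).
Proof.
by apply/matrixP => k j; rewrite !mxE !tnth_tset eq_sym (negbTE (neq_lift i k)).
Qed.

Lemma det_dlog_mxM t i x y : \det (dlog_mx (tset t i (x * y)%g)) =
  \det (dlog_mx (tset t i x)) + \det (dlog_mx (tset t i y)).
Proof.
rewrite -[\det (dlog_mx (tset t i x))]mul1r -[\det (dlog_mx (tset t i y))]mul1r.
apply: (determinant_multilinear (i0 := i)); [|exact: row'_dlog_mx|exact: row'_dlog_mx].
apply/rowP => j; rewrite !mxE !tnth_tset eqxx !mul1r.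
by rewrite dlogM // uvalP.
Qed.

(** If x + y = 1, then x dlog x + y dlog y = D(1) = 0, a linear relation between two rows. *)
Lemma det_dlog_mx_steinberg t (i j : 'I_n) : j = i.+1 :> nat ->
  uval (tnth t i) + uval (tnth t j) = 1 -> \det (dlog_mx t) = 0.
Proof.
move=> ij st; apply/eqP/det0P.
have ji : j != i by rewrite -val_eqE /= ij; rewrite neq_ltn ltnSn orbT.
pose u := \row_k
  (if k == i then uval (tnth t i) else if k == j then uval (tnth t j) else 0).
exists u.
  apply/eqP => /rowP/(_ i); rewrite !mxE eqxx => /eqP.
  by rewrite (negbTE (uvalP _)).
apply/rowP => k; rewrite !mxE (bigD1 i) //= (bigD1 j) //= big1 => [|l /andP[li lj]].
  rewrite !mxE eqxx (negbTE ji) eqxx addr0 /dlog.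
  rewrite ![_ * (_ / _)]mulrC !divfK ?uvalP //.
  by rewrite -(derD (hD k)) st (der1 charF (hD k)).
by rewrite !mxE (negbTE li) (negbTE lj) mul0r.
Qed.

(** The determinant is multilinear, respects the Steinberg relation and is killed by 2, so it
    defines a homomorphism on K_n(F)/2. *)
Lemma det_dlog_mx_ksym t : ksym_mod 2 t = 0 -> \det (dlog_mx t) = 0.
Proof.
have h2 u : \det (dlog_mx u) *+ 2 = 0 by rewrite mulrn_pchar.
rewrite -(milnor_liftE (m := 2) det_dlog_mxM det_dlog_mx_steinberg h2) => ->.
rewrite -(subrr 0) (milnor_lift_is_zmod_morphism det_dlog_mxM det_dlog_mx_steinberg h2).
exact: subrr.
Qed.

End Determinant.

Lemma ksym_mod2_dual n (t : n.-tuple (units F)) D :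
  (forall i, derivation (D i)) ->
  (forall i j, D i (uval (tnth t j)) = if i == j then uval (tnth t j) else 0) ->
  ksym_mod 2 t <> 0.
Proof.
move=> hD Dt /(det_dlog_mx_ksym hD); rewrite (_ : dlog_mx D t = 1%:M).
  by rewrite det1 => /eqP; rewrite oner_eq0.
apply/matrixP => i j; rewrite !mxE /dlog Dt eq_sym.
by have [_|_] := eqVneq i j; rewrite ?mul0r // mulfV // uvalP.
Qed.

End DlogDeterminant.

(** * Witt vectors of length two *)

Section Witt2.
Variable F : fieldType.

(* Witt vectors of length two for the prime 2, with ghost component
   [x0 ^ 2 + 2 x1]. *)
Record witt2 := Witt2 { wit0 : F; wit1 : F }.

Definition pair_of_witt2 x := (wit0 x, wit1 x).
Definition witt2_of_pair x := Witt2 x.1 x.2.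
Lemma pair_of_witt2K : cancel pair_of_witt2 witt2_of_pair.
Proof. by case. Qed.
HB.instance Definition _ := Choice.copy witt2 (can_type pair_of_witt2K).

Implicit Types x y z : witt2.

Definition witt2_add x y := Witt2 (wit0 x + wit0 y) (wit1 x + wit1 y - wit0 x * wit0 y).
Definition witt2_opp x := Witt2 (- wit0 x) (- wit1 x - wit0 x ^+ 2).
Definition witt2_mul x y :=
  Witt2 (wit0 x * wit0 y)
    (wit0 x ^+ 2 * wit1 y + wit1 x * wit0 y ^+ 2 + 2%:R * (wit1 x * wit1 y)).

Fact witt2_addA : associative witt2_add.
Proof. by move=> [a b] [c d] [e f]; congr Witt2 => /=; ring. Qed.
Fact witt2_addC : commutative witt2_add.
Proof. by move=> [a b] [c d]; congr Witt2 => /=; ring. Qed.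
Fact witt2_add0 : left_id (Witt2 0 0) witt2_add.
Proof. by move=> [a b]; congr Witt2 => /=; ring. Qed.
Fact witt2_addN : left_inverse (Witt2 0 0) witt2_opp witt2_add.
Proof. by move=> [a b]; congr Witt2 => /=; ring. Qed.
HB.instance Definition _ :=
  GRing.isZmodule.Build witt2 witt2_addA witt2_addC witt2_add0 witt2_addN.

Fact witt2_mulA : associative witt2_mul.
Proof. by move=> [a b] [c d] [e f]; congr Witt2 => /=; ring. Qed.
Fact witt2_mulC : commutative witt2_mul.
Proof. by move=> [a b] [c d]; congr Witt2 => /=; ring. Qed.
Fact witt2_mul1 : left_id (Witt2 1 0) witt2_mul.
Proof. by move=> [a b]; congr Witt2 => /=; ring. Qed.
Fact witt2_mulDl : left_distributive witt2_mul witt2_add.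
Proof. by move=> [a b] [c d] [e f]; congr Witt2 => /=; ring. Qed.
Fact witt2_1neq0 : Witt2 1 0 != 0 :> witt2.
Proof. by apply/eqP => -[/eqP]; rewrite oner_eq0. Qed.
HB.instance Definition _ := GRing.Zmodule_isComNzRing.Build witt2
  witt2_mulA witt2_mulC witt2_mul1 witt2_mulDl witt2_1neq0.

Definition teich (a : F) := Witt2 a 0.
Definition ver (a : F) := Witt2 0 a.

Lemma wit0D x y : wit0 (x + y) = wit0 x + wit0 y. Proof. by []. Qed.
Lemma wit0N x : wit0 (- x) = - wit0 x. Proof. by []. Qed.
Lemma wit0M x y : wit0 (x * y) = wit0 x * wit0 y. Proof. by []. Qed.

Lemma teichM a b : teich (a * b) = teich a * teich b.
Proof. by congr Witt2 => /=; ring. Qed.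
Lemma verD a b : ver (a + b) = ver a + ver b.
Proof. by congr Witt2 => /=; ring. Qed.
Lemma ver0 : ver 0 = 0. Proof. by []. Qed.
Lemma ver_inj : injective ver. Proof. by move=> a b []. Qed.
Hypothesis charF : 2%N \in [pchar F].

Lemma ver_sqrD a b : ver ((a + b) ^+ 2) = ver (a ^+ 2) + ver (b ^+ 2).
Proof. by rewrite sqrrD_char2 // verD. Qed.

Lemma verN a : - ver a = ver a.
Proof. by apply/esym/eqP; rewrite -addr_eq0 -verD addrr_pchar2. Qed.

Lemma mul_ver x a : x * ver a = ver (wit0 x ^+ 2 * a).
Proof. by congr Witt2 => /=; rewrite ?natr2_char2 //; ring. Qed.

Lemma witt2_mulE x y : x * y = teich (wit0 x * wit0 y) +
  ver (wit0 x ^+ 2 * wit1 y + wit1 x * wit0 y ^+ 2).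
Proof. by congr Witt2 => /=; rewrite ?natr2_char2 //; ring. Qed.

(** Multiplication by 2 is Verschiebung after Frobenius; hence 2x depends only on [wit0 x]. *)
Lemma witt2_double x : x + x = ver (wit0 x ^+ 2).
Proof.
case: x => a b; congr Witt2 => /=; rewrite ?addrr_pchar2 //.
by rewrite oppr_pchar2 // add0r expr2.
Qed.

Lemma witt2_mul4 x : x *+ 4 = 0.
Proof.
by rewrite (mulrnA x 2 2) !mulr2n witt2_double wit0D addrr_pchar2 // expr0n.
Qed.

(** An inverse only for nonzero [wit0 x]; the sign of the second component is dropped, as the
    characteristic is 2. *)
Definition witt2_inv x := Witt2 (wit0 x)^-1 (wit1 x / wit0 x ^+ 4).

Lemma mul_witt2V x : wit0 x != 0 -> x * witt2_inv x = 1.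
Proof.
case: x => a b /= a0; congr Witt2 => /=; first by rewrite mulfV.
rewrite natr2_char2 // mul0r addr0 -[RHS](addrr_pchar2 charF (b / a ^+ 2)).
by field.
Qed.

End Witt2.

(** * Lifting the derivations to a flat Z/4-lift of F *)

Section LiftedDerivations.
Variables (F : fieldType) (charF : 2%N \in [pchar F]).
Variables (n : nat) (D : 'I_n -> F -> F) (hD : forall i, derivation (D i)).
Local Notation W := (witt2 F).
Local Notation jet := (W * ('I_n -> W))%type.
Local Open Scope classical_set_scope.

(* A pair (s, v) records a Witt vector and the values at it of lifts of the
   derivations [D i]. *)
Inductive jets (A : set jet) : W -> ('I_n -> W) -> Prop :=
| jets_gen s v of A (s, v) : jets A s v
| jets_sqr x z :
    jets A (teich (x ^+ 2) + ver (z ^+ 2)) (fun i => ver ((x * D i x + D i z) ^+ 2))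
| jetsD s v s' v' of jets A s v & jets A s' v' :
    jets A (s + s') (fun i => v i + v' i)
| jetsM s v s' v' of jets A s v & jets A s' v' :
    jets A (s * s') (fun i => v i * s' + s * v' i).

Lemma jets_eq A s v s' v' : jets A s v -> s = s' -> v =1 v' -> jets A s' v'.
Proof. by move=> h <- /funext <-. Qed.

Lemma jetsS A B s v : A `<=` B -> jets A s v -> jets B s v.
Proof.
move=> AB; elim=> [r w /AB|||].
- exact: jets_gen.
- exact: jets_sqr.
- by move=> *; apply: jetsD.
- by move=> *; apply: jetsM.
Qed.

Lemma jets0 A : jets A 0 (fun=> 0).
Proof.
apply: jets_eq (jets_sqr A 0 0) _ _; first by rewrite expr0n addr0.
by move=> i; rewrite der0 // mul0r addr0 expr0n.
Qed.

Lemma jets1 A : jets A 1 (fun=> 0).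
Proof.
apply: jets_eq (jets_sqr A 1 0) _ _; first by rewrite expr1n expr0n ver0 addr0.
by move=> i; rewrite der0 // der1 // mulr0 addr0 expr0n.
Qed.

(** In characteristic 2 the Witt vector -1 is (1, 1), so [jets_sqr] already provides negation. *)
Lemma jetsN1 A : jets A (- 1) (fun=> 0).
Proof.
apply: jets_eq (jets_sqr A 1 1) _ _.
  apply: (addrI 1); rewrite expr1n subrr addrA witt2_double // -verD expr1n.
  by rewrite addrr_pchar2.
by move=> i; rewrite der1 // mulr0 addr0 expr0n.
Qed.

Lemma jetsB A s v s' v' : jets A s v -> jets A s' v' ->
  jets A (s - s') (fun i => v i - v' i).
Proof.
move=> h h'; apply: jets_eq (jetsD h (jetsM (jetsN1 A) h')) _ _.
  by rewrite mulN1r.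
by move=> i /=; rewrite mul0r add0r mulN1r.
Qed.

(** The second clause encodes flatness over Z/4: since ver(z^2) = 2 teich(z), an element reducing to
    0 is twice a lift of some z, and its derivative is 2 D z. In particular s = 0 forces v = 0. *)
Definition flat_jet (s : W) (v : 'I_n -> W) :=
  (forall i, wit0 (v i) = D i (wit0 s)) /\
  (wit0 s = 0 -> exists2 z, s = ver (z ^+ 2) & forall i, v i = ver (D i z ^+ 2)).

Definition flat A := forall s v, jets A s v -> flat_jet s v.

(** Without generators only the elements teich(x)^2 + 2 teich(z) arise, with derivative 2 (x D x + D
    z); sums and products keep this form. *)
Lemma flat0 : flat set0.
Proof.
move=> s v h; suff [x [z [-> hv]]] : exists x z, s = teich (x ^+ 2) + ver (z ^+ 2)
    /\ forall i, v i = ver ((x * D i x + D i z) ^+ 2).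
  split=> [i|/=]; first by rewrite hv /= addr0 der_sqr.
  rewrite addr0 => /eqP; rewrite sqrf_eq0 => /eqP x0; exists z.
    by rewrite x0 expr0n add0r.
  by move=> i; rewrite hv x0 mul0r add0r.
elim: h => {s v}[s v []|x z|s v s' v' _ [x [z [-> hv]]] _ [x' [z' [-> hv']]]
  |s v s' v' _ [x [z [-> hv]]] _ [x' [z' [-> hv']]]].
- by exists x, z.
- exists (x + x'), (z + z' + x * x'); split.
    by congr Witt2; rewrite /= ?sqrrD_char2 // ?oppr_pchar2 //; ring.
  move=> i; rewrite hv hv' -ver_sqrD //; congr (ver (_ ^+ 2)).
  rewrite !(derD (hD i)) (derM (hD i)).
  by rewrite -[LHS]addr0 -(addrr_pchar2 charF (x * D i x' + D i x * x')); ring.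
exists (x * x'), (x ^+ 2 * z' + x' ^+ 2 * z); split.
  by congr Witt2; rewrite /= ?sqrrD_char2 // ?natr2_char2 //; ring.
move=> i; rewrite hv hv' [ver _ * _]mulrC !mul_ver // -verD /= !addr0.
rewrite -!exprMn -sqrrD_char2 //; congr (ver (_ ^+ 2)).
have sqM u w : D i (u ^+ 2 * w) = u ^+ 2 * D i w.
  by rewrite (derM (hD i)) der_sqr // mul0r add0r.
by rewrite (derD (hD i)) !sqM (derM (hD i)); ring.
Qed.

Lemma jets_bigcup (C : set (set jet)) s v : total_on C subset ->
  jets (\bigcup_(A in C) A) s v -> jets set0 s v \/ exists2 A, C A & jets A s v.
Proof.
move=> totC; pose H s v := jets set0 s v \/ exists2 A, C A & jets A s v.
have dir r w r' w' : H r w -> H r' w' ->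
    exists2 A, (forall s v, jets A s v -> H s v) & jets A r w /\ jets A r' w'.
  have S0 A r0 w0 : jets set0 r0 w0 -> jets A r0 w0 by apply: jetsS.
  have SC A : C A -> forall s v, jets A s v -> H s v.
    by move=> CA s0 v0 h; right; exists A.
  case=> [h|[A CA h]] [h'|[A' CA' h']].
  - by exists set0 => // s0 v0 ?; left.
  - by exists A'; [exact: SC|split=> //; exact: S0].
  - by exists A; [exact: SC|split=> //; exact: S0].
  have [AA'|A'A] := totC _ _ CA CA'.
    by exists A'; [exact: SC|split=> //; exact: jetsS h].
  by exists A; [exact: SC|split=> //; exact: jetsS h'].
elim=> {s v}[s v [A CA As]|x z|s v s' v' _ h _ h'|s v s' v' _ h _ h'].
- by right; exists A => //; apply: jets_gen.
- by left; apply: jets_sqr.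
- by have [A HA [h1 h2]] := dir _ _ _ _ h h'; apply: HA; apply: jetsD.
- by have [A HA [h1 h2]] := dir _ _ _ _ h h'; apply: HA; apply: jetsM.
Qed.

(** The square of teich(t) is already covered by [jets_sqr], so adjoining teich(t) to the ring R of
    jets gives R + R teich(t). *)
Lemma jets_setU1 A t s v :
  jets (A `|` [set (teich t, fun i => teich (D i t))]) s v ->
  exists s1 v1 s2 v2, [/\ jets A s1 v1, jets A s2 v2, s = s1 + s2 * teich t
    & forall i, v i = v1 i + v2 i * teich t + s2 * teich (D i t)].
Proof.
elim=> {s v}[s v [As|[-> ->]]|x z
  |s v s' v' _ [s1 [v1 [s2 [v2 [h1 h2 -> hv]]]]]
    _ [s1' [v1' [s2' [v2' [h1' h2' -> hv']]]]]
  |s v s' v' _ [s1 [v1 [s2 [v2 [h1 h2 -> hv]]]]]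
    _ [s1' [v1' [s2' [v2' [h1' h2' -> hv']]]]]].
- exists s, v, 0, (fun=> 0).
  split; [exact: jets_gen|exact: jets0|by rewrite mul0r addr0|].
  by move=> i; rewrite !mul0r !addr0.
- exists 0, (fun=> 0), 1, (fun=> 0).
  split; [exact: jets0|exact: jets1|by rewrite mul1r add0r|].
  by move=> i; rewrite mul0r mul1r !add0r.
- exists (teich (x ^+ 2) + ver (z ^+ 2)), (fun i => ver ((x * D i x + D i z) ^+ 2)).
  exists 0, (fun=> 0).
  split; [exact: jets_sqr|exact: jets0|by rewrite mul0r addr0|].
  by move=> i; rewrite !mul0r !addr0.
- exists (s1 + s1'), (fun i => v1 i + v1' i), (s2 + s2'), (fun i => v2 i + v2' i).
  split; [exact: jetsD|exact: jetsD|by ring|].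
  by move=> i; rewrite hv hv'; ring.
have hsq : jets A (teich t * teich t)
    (fun i => teich t * teich (D i t) + teich t * teich (D i t)).
  apply: jets_eq (jets_sqr A t 0) _ _.
    by rewrite expr0n ver0 addr0 expr2 teichM.
  by move=> i; rewrite witt2_double //= der0 // addr0.
exists (s1 * s1' + s2 * s2' * (teich t * teich t)), (fun i =>
  (v1 i * s1' + s1 * v1' i) + ((v2 i * s2' + s2 * v2' i) * (teich t * teich t) +
    s2 * s2' * (teich t * teich (D i t) + teich t * teich (D i t)))),
  (s1 * s2' + s2 * s1'), (fun i => (v1 i * s2' + s1 * v2' i) + (v2 i * s1' + s2 * v1' i)).
split.
- by apply: jetsD; first exact: jetsM; apply: (jetsM (jetsM h2 h2') hsq).
- by apply: jetsD; apply: jetsM.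
- by ring.
by move=> i; rewrite hv hv'; ring.
Qed.

(** The residues of the jets form a subfield without t. So s1 + s2 teich(t) reduces to 0 only if s1
    and s2 do, and flatness then applies to both. *)
Lemma flat_setU1 A t : flat A -> ~ (exists s v, jets A s v /\ wit0 s = t) ->
  flat (A `|` [set (teich t, fun i => teich (D i t))]).
Proof.
move=> flA nt _ v /jets_setU1[s1 [v1 [s2 [v2 [h1 h2 -> hv]]]]].
have [w1 k1] := flA _ _ h1; have [w2 k2] := flA _ _ h2; split.
  by move=> i; rewrite hv !wit0D !wit0M /= w1 w2 (derD (hD i)) (derM (hD i)) addrA.
rewrite wit0D wit0M /= => e0.
have hE : subfield2 (fun x => exists s v, jets A s v /\ wit0 s = x).
  split=> [_ _ [s [w [h <-]]] [s' [w' [h' <-]]]|_ _ [s [w [h <-]]] [s' [w' [h' <-]]]|x].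
  - by exists (s + s'), (fun i => w i + w' i); split=> //; exact: jetsD.
  - by exists (s * s'), (fun i => w i * s' + s * w' i); split=> //; exact: jetsM.
  exists (teich (x ^+ 2) + ver (0 ^+ 2)), (fun i => ver ((x * D i x + D i 0) ^+ 2)).
  by split; [exact: jets_sqr|rewrite /= addr0].
have s20 : wit0 s2 = 0.
  apply: contrapT => /eqP s20; apply: nt.
  have -> : t = wit0 s1 / wit0 s2.
    apply: (mulIf s20); rewrite divfK //; apply/eqP.
    by rewrite mulrC -subr_eq0 oppr_pchar2 // addrC e0.
  by apply: (subfield2_div hE); [exists s1, v1|exists s2, v2].
have s10 : wit0 s1 = 0 by move: e0; rewrite s20 mul0r addr0.
have [z1 e1 hv1] := k1 s10; have [z2 e2 hv2] := k2 s20.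
exists (z1 + z2 * t).
  by rewrite e1 e2 mulrC mul_ver //= ver_sqrD // exprMn mulrC.
move=> i; rewrite hv hv1 hv2 e2 mulrC mul_ver //= [ver _ * _]mulrC mul_ver //=.
rewrite -!exprMn -!ver_sqrD // (derD (hD i)) (derM (hD i)) addrA.
by congr (ver (_ ^+ 2)); ring.
Qed.

(** By Zorn's lemma there is a maximal flat A; an element of F without a lift could still be
    adjoined by [flat_setU1]. *)
Lemma lift_derivations : exists J : W -> ('I_n -> W) -> Prop,
  [/\ exists A, J = jets A, forall s v, J s v -> flat_jet s v
    & forall x, exists s v, J s v /\ wit0 s = x].
Proof.
have [A [flA maxA]] : exists A, flat A /\ forall B, A `<` B -> ~ flat B.
  apply: (@Zorn_bigcup jet [set A | flat A]) => C sub totC s v.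
  by move=> /(jets_bigcup totC)[/flat0|[A /sub]] //; apply.
exists (jets A); split=> [|//|x]; first by exists A.
apply: contrapT => nx; apply: (maxA _ _ (flat_setU1 flA nx)).
split; first exact: subsetUl.
move=> /(_ (teich x, fun i => teich (D i x))) h; apply: nx.
exists (teich x), (fun i => teich (D i x)); split=> //.
by apply: jets_gen; apply: h; right.
Qed.

End LiftedDerivations.

(** * The map dlog on K_2(F)/4 *)

Section DlogMod4.
Variables (F : fieldType) (charF : 2%N \in [pchar F]).
Variables (n : nat) (D : 'I_n -> F -> F) (hD : forall i, derivation (D i)).
Hypothesis DC : forall i j x, D i (D j x) = D j (D i x).
Local Notation W := (witt2 F).
Local Notation U := (units F).
Variables (A : set (W * ('I_n -> W))).
Hypothesis flA : flat D A.
Variables (lift : F -> W) (lift_der : F -> 'I_n -> W).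
Hypothesis lift_jet : forall x, jets D A (lift x) (lift_der x).
Hypothesis wit0_lift : forall x, wit0 (lift x) = x.

Definition dlog_lift (x : F) i : W := lift_der x i * witt2_inv (lift x).

Lemma wit0_dlog_lift x i : wit0 (dlog_lift x i) = dlog (D i) x.
Proof. by rewrite wit0M /= (flA (lift_jet x)).1 wit0_lift. Qed.

(** Two lifts differ by some ver(y^2) = 2 teich(y), so their logarithmic derivatives differ by 2
    d(y/s). Thus dlog depends on the lift only up to twice an exact form. *)
Lemma jet_dlog_eq s v s' v' : jets D A s v -> jets D A s' v' ->
  wit0 s != 0 -> wit0 s' = wit0 s ->
  exists z, forall i, v' i * witt2_inv s' = v i * witt2_inv s + ver (D i z ^+ 2).
Proof.
move=> h h' s0 ss'; have [_ /(_ _)[|y def_s def_v]] := flA (jetsB charF hD h' h).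
  by rewrite wit0D wit0N ss' subrr.
exists (y / wit0 s) => i.
have s'0 : wit0 s' != 0 by rewrite ss'.
have u := mul_witt2V charF s0; have u' := mul_witt2V charF s'0.
have def_s' : s' = s + ver (y ^+ 2) by rewrite -def_s addrC subrK.
have def_v' : v' i = v i + ver (D i y ^+ 2) by rewrite -def_v addrC subrK.
suff e : v' i = s' * (v i * witt2_inv s + ver (D i (y / wit0 s) ^+ 2)).
  by rewrite {1}e mulrAC u' mul1r.
rewrite {1}def_s' mulrDl mulrDr mulrCA u mulr1 def_v' -addrA; congr (_ + _).
rewrite [ver _ * _]mulrC !mul_ver // -verD wit0D wit0M /= addr0; congr ver.
have [-> _] := flA h; rewrite (derM (hD i)) (derV charF (hD i)) //.
rewrite oppr_pchar2 // -!exprMn -sqrrD_char2 //; congr (_ ^+ 2).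
rewrite -[LHS]addr0 -(addrr_pchar2 charF (D i (wit0 s) * y / wit0 s)); field.
by rewrite s0.
Qed.

Lemma dlog_liftM x y : x != 0 -> y != 0 ->
  exists z, forall i,
    dlog_lift (x * y) i = dlog_lift x i + dlog_lift y i + ver (D i z ^+ 2).
Proof.
move=> x0 y0.
have [||z hz] := jet_dlog_eq (jetsM (lift_jet x) (lift_jet y)) (lift_jet (x * y)).
- by rewrite wit0M !wit0_lift mulf_neq0.
- by rewrite wit0M !wit0_lift.
exists z => i; rewrite /dlog_lift hz; congr (_ + _).
have ux : lift x * witt2_inv (lift x) = 1 by apply: mul_witt2V; rewrite ?wit0_lift.
have uy : lift y * witt2_inv (lift y) = 1 by apply: mul_witt2V; rewrite ?wit0_lift.
have uxy : lift x * lift y * witt2_inv (lift x * lift y) = 1.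
  by apply: mul_witt2V; rewrite // wit0M !wit0_lift mulf_neq0.
set a := lift_der x i; set b := lift_der y i.
transitivity ((lift x * lift y * witt2_inv (lift x * lift y)) *
  (a * witt2_inv (lift x) * (lift y * witt2_inv (lift y)) +
   b * witt2_inv (lift y) * (lift x * witt2_inv (lift x)))).
  transitivity (
    (a * (lift x * witt2_inv (lift x)) * lift y * (lift y * witt2_inv (lift y)) +
    lift x * (lift x * witt2_inv (lift x)) * (lift y * witt2_inv (lift y)) * b) *
      witt2_inv (lift x * lift y)); last by ring.
  by rewrite ux uy !mulr1.
by rewrite ux uy uxy !mulr1 mul1r.
Qed.

Definition wedge (x y : F) : 'M[W]_n :=
  \matrix_(i, j) (dlog_lift x i * dlog_lift y j - dlog_lift x j * dlog_lift y i).

(** The coefficients of 2 d(eta): doubling sends a Witt vector to the Verschiebung of its squared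
    first component, and the sign disappears. *)
Definition double_exact (M : 'M[W]_n) :=
  exists eta : 'I_n -> F, forall i j, M i j = ver ((D i (eta j) + D j (eta i)) ^+ 2).

Lemma double_exactB M N : double_exact M -> double_exact N -> double_exact (M - N).
Proof.
move=> [e he] [f hf]; exists (fun i => e i + f i) => i j.
rewrite !mxE he hf verN // -ver_sqrD //; congr (ver (_ ^+ 2)).
by rewrite !(derD (hD _)); ring.
Qed.

Lemma double_exact0 : double_exact 0.
Proof.
by exists (fun=> 0) => i j; rewrite mxE !(der0 (hD _)) addr0 expr0n.
Qed.

Lemma double_exactN M : double_exact M -> double_exact (- M).
Proof. by rewrite -sub0r; apply: double_exactB double_exact0. Qed.

Lemma double_exactD M N : double_exact M -> double_exact N -> double_exact (M + N).
Proof. by move=> hM /double_exactN; rewrite -{2}[N]opprK; apply: double_exactB. Qed.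

Lemma zspanned_double_exact M : zspanned double_exact M -> double_exact M.
Proof. by elim=> // [|*]; [exact: double_exact0|exact: double_exactB]. Qed.

Lemma wedgeN x y : wedge y x = - wedge x y.
Proof. by apply/matrixP => i j; rewrite !mxE; ring. Qed.

Lemma derC_dlog i j x : x != 0 -> D i (dlog (D j) x) = D j (dlog (D i) x).
Proof.
move=> x0; rewrite /dlog !(derM (hD _)) !(derV charF (hD _)) // (DC i j).
by field.
Qed.

(* d z /\ dlog y = d (z dlog y) *)
Lemma double_exact_dlog z y (M : 'M[W]_n) : y != 0 ->
  (forall i j,
    M i j = ver (D i z ^+ 2) * dlog_lift y j - ver (D j z ^+ 2) * dlog_lift y i) ->
  double_exact M.
Proof.
move=> y0 hM; exists (fun i => z * dlog (D i) y) => i j.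
rewrite hM ![ver _ * _]mulrC !mul_ver // verN // !wit0_dlog_lift -!exprMn -ver_sqrD //.
congr (ver (_ ^+ 2)); rewrite (derM (hD i) z) (derM (hD j) z) (derC_dlog i j) //.
rewrite -[LHS]addr0 -(addrr_pchar2 charF (z * D j (dlog (D i) y))); ring.
Qed.

Lemma wedgeMl x x' y : x != 0 -> x' != 0 -> y != 0 ->
  double_exact (wedge (x * x') y - (wedge x y + wedge x' y)).
Proof.
move=> x0 x'0 y0; have [z hz] := dlog_liftM x0 x'0.
apply: (double_exact_dlog (z := z) y0) => i j.
by rewrite !mxE !hz; ring.
Qed.

Lemma wedgeMr x y y' : x != 0 -> y != 0 -> y' != 0 ->
  double_exact (wedge x (y * y') - (wedge x y + wedge x y')).
Proof.
move=> x0 y0 y'0; have -> : wedge x (y * y') - (wedge x y + wedge x y') =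
    - (wedge (y * y') x - (wedge y x + wedge y' x)).
  by rewrite (wedgeN x (y * y')) (wedgeN x y) (wedgeN x y') -!opprD opprK.
by apply: double_exactN; exact: wedgeMl.
Qed.

(** 1 - lift x is also a lift of y, and its logarithmic derivative is proportional to that of lift
    x. The wedge therefore vanishes up to the correction for changing the lift. *)
Lemma wedge_steinberg x y : x != 0 -> y != 0 -> x + y = 1 -> double_exact (wedge x y).
Proof.
move=> x0 y0 xy.
have j1 : jets D A (1 - lift x) (fun i => 0 - lift_der x i).
  by apply: jetsB => //; exact: jets1.
have w1 : wit0 (1 - lift x) = y.
  by rewrite wit0D wit0N wit0_lift /= -xy addrAC subrr add0r.
have [||z hz] := jet_dlog_eq j1 (lift_jet y); rewrite ?w1 ?wit0_lift //.
rewrite (wedgeN y x); apply/double_exactN/(double_exact_dlog (z := z) x0) => i j.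
rewrite !mxE /dlog_lift !hz; ring.
Qed.

Definition wedge_class (t : 2.-tuple U) : zquot double_exact :=
  zproj double_exact (wedge (uval (tnth t ord0)) (uval (tnth t ord_max))).

Lemma wedge_classM t i x y : wedge_class (tset t i (x * y)%g) =
  wedge_class (tset t i x) + wedge_class (tset t i y).
Proof.
rewrite /wedge_class -raddfD; apply/zproj_eq/zspanned_gen.
rewrite !tnth_tset; case: i => -[|[|//]] p /=.
  by apply: wedgeMl; exact: uvalP.
by apply: wedgeMr; exact: uvalP.
Qed.

Lemma wedge_class_steinberg t (i j : 'I_2) : j = i.+1 :> nat ->
  uval (tnth t i) + uval (tnth t j) = 1 -> wedge_class t = 0.
Proof.
move=> ij st; rewrite /wedge_class -(raddf0 (zproj double_exact)).
apply/zproj_eq/zspanned_gen; rewrite subr0; apply: wedge_steinberg; rewrite ?uvalP //.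
suff [-> ->] : ord0 = i :> 'I_2 /\ ord_max = j :> 'I_2 by [].
by split; apply: val_inj; case: i j ij {st} => [[|[|]]] //= ? [[|[|]]].
Qed.

Lemma wedge_class4 t : wedge_class t *+ 4 = 0.
Proof.
rewrite /wedge_class -raddfMn -(raddf0 (zproj double_exact)); congr zproj.
by apply/matrixP => i j; rewrite mulmxnE !mxE witt2_mul4.
Qed.

(** Apply the homomorphism on K_2(F)/4 induced by [wedge]; it sends {a, b^2}_4 to the class of 2
    dlog a dlog b. *)
Lemma wedge_mod4 a b c d alpha beta :
  K2_emb (ksym_mod 2 [tuple a; b] + ksym_mod 2 [tuple c; d]) =
    ksym_mod 4 [tuple alpha; beta] ->
  double_exact (wedge (uval a) (uval b) *+ 2 + wedge (uval c) (uval d) *+ 2 -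
    wedge (uval alpha) (uval beta)).
Proof.
pose f := milnor_lift (m := 4) wedge_class.
have fD : zmod_morphism f.
  exact: milnor_lift_is_zmod_morphism wedge_classM wedge_class_steinberg wedge_class4.
have fE x y : f (ksym_mod 4 [tuple x; y]) = zproj double_exact (wedge (uval x) (uval y)).
  exact: milnor_liftE wedge_classM wedge_class_steinberg wedge_class4 _.
have f0 : f 0 = 0 by rewrite -(subrr 0) fD subrr.
have fA x y : f (x + y) = f x + f y.
  by rewrite -{1}[y]opprK fD -[- y]sub0r fD f0 sub0r opprK.
rewrite raddfD /= !K2_embE => /(congr1 f); rewrite fA !fE.
have e x y : wedge (uval x) (uval (y ^+ 2)%g) = wedge (uval x) (uval y * uval y) by [].
rewrite !e -raddfD /= => /zproj_eq/zspanned_double_exact h.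
have hab := wedgeMr (uvalP a) (uvalP b) (uvalP b).
have hcd := wedgeMr (uvalP c) (uvalP d) (uvalP d).
have := double_exactB h (double_exactD hab hcd); congr double_exact.
by rewrite !mulr2n addrAC [in LHS]addrACA -opprD subKr.
Qed.

End DlogMod4.

(** * Pfaffians of 2-forms in four variables: the sum is not a symbol *)

Section Pfaffian.
Variables (F : fieldType) (charF : 2%N \in [pchar F]).

(** N is the product of the commuting operators 1 - D_i, and (1 - D_i) D_i = 0. *)
Lemma der_annihilator n (D : 'I_n -> F -> F) : (forall i, derivation (D i)) ->
  (forall i j x, D i (D j x) = D j (D i x)) -> (forall i x, D i (D i x) = D i x) ->
  exists N : F -> F, [/\ {morph N : x y / x + y}, N 1 = 1 & forall i x, N (D i x) = 0].
Proof.
move=> hD DC Did; pose N s := foldr (fun i (f : F -> F) x => f x - D i (f x)) id s.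
have ND s : {morph N s : x y / x + y}.
  by elim: s => //= i s IH x y; rewrite IH (derD (hD i)); ring.
have NDC s i x : N s (D i x) = D i (N s x).
  by elim: s => //= j s ->; rewrite (derB charF (hD i)) DC.
have N0 s i x : i \in s -> N s (D i x) = 0.
  elim: s => //= j s IH; rewrite inE => /predU1P[->|/IH ->].
    by rewrite NDC Did subrr.
  by rewrite (der0 (hD j)) subrr.
exists (N (enum 'I_n)); split=> // [|i x]; last by apply: N0; rewrite mem_enum.
by elim: (enum _) => //= j s ->; rewrite (der1 charF (hD j)) subr0.
Qed.

Local Notation i0 := (@Ordinal 4 0 isT).
Local Notation i1 := (@Ordinal 4 1 isT).
Local Notation i2 := (@Ordinal 4 2 isT).
Local Notation i3 := (@Ordinal 4 3 isT).

Definition pfaffian (G : 'I_4 -> 'I_4 -> F) :=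
  G i0 i1 * G i2 i3 - G i0 i2 * G i1 i3 + G i0 i3 * G i1 i2.

Lemma pfaffian_sqr (G : 'I_4 -> 'I_4 -> F) :
  pfaffian (fun i j => G i j ^+ 2) = pfaffian G ^+ 2.
Proof.
by rewrite /pfaffian -!exprMn !(oppr_pchar2 charF) !(sqrrD_char2 charF).
Qed.

(* [G = u /\ mu + la /\ w], whose Pfaffian is u /\ mu /\ la /\ w. *)
Lemma pfaffian_proportional (u w mu la : 'I_4 -> F) (G : 'I_4 -> 'I_4 -> F) :
  (forall i j, u i * w j = u j * w i) ->
  (forall i j, G i j = u i * mu j - u j * mu i + (la i * w j - la j * w i)) ->
  pfaffian G = 0.
Proof.
move=> uw GE; have h i j : u i * w j - u j * w i = 0 by rewrite uw subrr.
pose g i j := mu i * la j - mu j * la i.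
transitivity ((u i0 * w i1 - u i1 * w i0) * g i2 i3
  - (u i0 * w i2 - u i2 * w i0) * g i1 i3
  + (u i0 * w i3 - u i3 * w i0) * g i1 i2
  + (u i1 * w i2 - u i2 * w i1) * g i0 i3
  - (u i1 * w i3 - u i3 * w i1) * g i0 i2 + (u i2 * w i3 - u i3 * w i2) * g i0 i1).
  by rewrite /pfaffian !GE /g; ring.
by rewrite !h !mul0r !subr0 !addr0.
Qed.

(* The Pfaffian of d eta is the closed form d(sum_(i < j) eta_i e_i d(eta_j) e_j). *)
Lemma pfaffian_exact (D : 'I_4 -> F -> F) (eta : 'I_4 -> F) :
  (forall i, derivation (D i)) ->
  (forall i j x, D i (D j x) = D j (D i x)) ->
  exists X : 'I_4 -> F, pfaffian (fun i j => D i (eta j) - D j (eta i)) =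
    D i0 (X i0) + D i1 (X i1) + D i2 (X i2) + D i3 (X i3).
Proof.
move=> hD DC; pose e i j k := eta i * D j (eta k).
exists (fun i => nth 0 [:: e i1 i2 i3 - e i1 i3 i2 - e i2 i1 i3;
  e i2 i0 i3 + e i0 i3 i2 - e i0 i2 i3; e i0 i1 i3 - e i0 i3 i1 - e i1 i0 i3;
  e i1 i0 i2 + e i0 i2 i1 - e i0 i1 i2] i).
rewrite /pfaffian /= !(derB charF (hD _), derD (hD _)) /e !(derM (hD _)).
rewrite (DC i1 i0) (DC i2 i0) (DC i2 i1) (DC i3 i0) (DC i3 i1) (DC i3 i2).
by ring.
Qed.

Section NotSymbol.
Variables (D : 'I_4 -> F -> F) (hD : forall i, derivation (D i)).
Hypotheses (DC : forall i j x, D i (D j x) = D j (D i x))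
  (Did : forall i x, D i (D i x) = D i x).

(** Expanding gives 1 + (d eta)_01 + (d eta)_23 + Pf(d eta). All terms but 1 are sums of D_i-images,
    so N maps the total to 1. *)
Lemma pfaffian_exact_neq0 (eta : 'I_4 -> F) :
  pfaffian (fun i j => ((i == i0) && (j == i1) || (i == i2) && (j == i3))%:R
    + (D i (eta j) - D j (eta i))) != 0.
Proof.
have [N [ND N1 N0]] := der_annihilator hD DC Did.
have [X hX] := pfaffian_exact eta hD DC.
have hN : N (pfaffian (fun i j => D i (eta j) - D j (eta i))) = 0.
  by rewrite hX !ND !N0 !addr0.
apply: contra_neq (oner_neq0 F) => h; rewrite -N1.
have NDD i j x y : N (D i x - D j y) = 0.
  by rewrite oppr_pchar2 // ND !N0 addr0.
transitivity (N (1 + (D i0 (eta i1) - D i1 (eta i0)) + (D i2 (eta i3) - D i3 (eta i2))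
   + pfaffian (fun i j => D i (eta j) - D j (eta i)))).
  by rewrite (ND _ (pfaffian _)) (ND _ (D i2 _ - _)) (ND 1) !NDD hN !addr0.
have N00 : N 0 = 0 by have := N0 i0 0; rewrite (der0 (hD i0)).
by rewrite -[RHS]N00 -h /pfaffian /=; congr N; ring.
Qed.

Variables (a b c d : units F).
Hypothesis Dt : forall i j, D i (uval (tnth [tuple a; b; c; d] j)) =
  if i == j then uval (tnth [tuple a; b; c; d] j) else 0.

Lemma K2_emb_not_symbol alpha beta :
  K2_emb (ksym_mod 2 [tuple a; b] + ksym_mod 2 [tuple c; d]) <>
    ksym_mod 4 [tuple alpha; beta].
Proof.
have [J [[A defJ] flJ surJ]] := lift_derivations charF hD; subst J.
have [s /choice[v hsv]] := choice surJ.
have jsv x : jets D A (s x) (v x) by have [] := hsv x.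
have w0 x : wit0 (s x) = x by have [] := hsv x.
move=> /(wedge_mod4 charF hD DC flJ jsv w0)[eta].
have [L defL] : exists L, L = dlog_lift s v by eexists.
have lE x i : wit0 (L x i) = dlog (D i) x.
  by rewrite defL; exact: (wit0_dlog_lift flJ jsv w0).
pose t := [tuple a; b; c; d].
have lt i j : dlog (D i) (uval (tnth t j)) = (i == j)%:R.
  by rewrite /dlog Dt; case: eqP => _; rewrite ?mul0r // mulfV // uvalP.
pose th i j := dlog (D i) (uval a) * dlog (D j) (uval b) -
    dlog (D j) (uval a) * dlog (D i) (uval b) +
  (dlog (D i) (uval c) * dlog (D j) (uval d) - dlog (D j) (uval c) * dlog (D i) (uval d)).
pose G i j := th i j + (D i (eta j) - D j (eta i)).
set x := uval alpha; set y := uval beta.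
(* The equation dlog alpha dlog beta = 2 theta over W_2(F); [G] holds the coefficients of theta. *)
move=> h; have key i j : L x i * L y j - L x j * L y i = ver (G i j ^+ 2).
  have dbl (z w : F) : L z i * L w j - L z j * L w i + (L z i * L w j - L z j * L w i) =
      ver ((dlog (D i) z * dlog (D j) w - dlog (D j) z * dlog (D i) w) ^+ 2).
    by rewrite witt2_double // wit0D wit0N !wit0M !lE.
  have := h i j; rewrite !mulr2n !mxE -!defL !dbl => /eqP.
  rewrite subr_eq => /eqP e; apply: (addrI (ver ((D i (eta j) + D j (eta i)) ^+ 2))).
  rewrite -e -!ver_sqrD //; congr (ver (_ ^+ 2)); rewrite -/(th i j) /G.
  by rewrite oppr_pchar2 // addrCA addrr_pchar2 // addr0.
(* First Witt component: the reductions of dlog alpha and dlog beta are proportional. *)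
have prop i j : dlog (D i) x * dlog (D j) y = dlog (D j) x * dlog (D i) y.
  by apply/eqP; rewrite -subr_eq0 -!lE; have := congr1 (@wit0 F) (key i j) => /= ->.
have G0 : pfaffian G = 0.
  apply/eqP; rewrite -sqrf_eq0 -pfaffian_sqr; apply/eqP.
  (* Second Witt component: once the Teichmueller parts cancel, the squared coefficients of theta
     combine the squares of the first components of dlog alpha and dlog beta with their second
     components. *)
  apply: (@pfaffian_proportional (fun i => dlog (D i) x ^+ 2) (fun i => dlog (D i) y ^+ 2)
    (fun i => wit1 (L y i)) (fun i => wit1 (L x i))) => i j.
    by rewrite -!exprMn prop.
  apply: (@ver_inj F); rewrite -key !witt2_mulE // !lE prop opprD addrACA subrr add0r.
  by rewrite !verN // -verD !oppr_pchar2 //; congr ver; ring.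
have la i : dlog (D i) (uval a) = (i == i0)%:R := lt i i0.
have lb i : dlog (D i) (uval b) = (i == i1)%:R := lt i i1.
have lc i : dlog (D i) (uval c) = (i == i2)%:R := lt i i2.
have ld i : dlog (D i) (uval d) = (i == i3)%:R := lt i i3.
have /eqP := pfaffian_exact_neq0 eta; apply.
rewrite -[RHS]G0 /pfaffian /G /th !la !lb !lc !ld /=.
by ring.
Qed.
End NotSymbol.

End Pfaffian.

(** * The four ways to be dependent, and the equivalence *)

Section Dependence.
Variables (F : fieldType) (charF : 2%N \in [pchar F]).

(** The orders suit [mod4_symbol_dependent]: first the symbol without the dependent entry, then the
    partner of that entry, then the entry itself. *)
Definition some_dependent (a b c d : F) :=
  [\/ dependent c d b a, dependent c d a b, dependent a b d c | dependent a b c d].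

Lemma K4_some_dependent a b c d : a != 0 -> b != 0 -> c != 0 -> d != 0 ->
  some_dependent a b c d -> K4 a b c d = 0.
Proof.
move=> a0 b0 c0 d0; have rot := @K4_rot F charF.
case=> h; last exact: K4_dependent.
- rewrite rot // (smC charF (K4_steinberg01 d a)) // (smC charF (K4_steinberg12 c a)) //.
  exact: K4_dependent.
- by rewrite rot // rot //; exact: K4_dependent.
- by rewrite (smC charF (K4_steinberg23 a b)) //; exact: K4_dependent.
Qed.

Lemma mod4_symbol_some_dependent a b c d : a != 0 -> b != 0 -> c != 0 -> d != 0 ->
  some_dependent a b c d -> mod4_symbol (K2 a b + K2 c d).
Proof.
move=> a0 b0 c0 d0; have sC := smC charF (K2_steinberg F).
case=> h; last by rewrite (sC c d) //; exact: mod4_symbol_dependent.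
- by rewrite addrC; exact: mod4_symbol_dependent.
- by rewrite addrC (sC a b) //; exact: mod4_symbol_dependent.
- exact: mod4_symbol_dependent.
Qed.

Lemma dual_derivations4 (t : 4.-tuple (units F)) :
  ~ some_dependent (uval (tnth t (@Ordinal 4 0 isT))) (uval (tnth t (@Ordinal 4 1 isT)))
     (uval (tnth t (@Ordinal 4 2 isT))) (uval (tnth t (@Ordinal 4 3 isT))) ->
  exists D : 'I_4 -> F -> F, [/\ forall i, derivation (D i),
    forall i j x, D i (D j x) = D j (D i x), forall i x, D i (D i x) = D i x
    & forall i j, D i (uval (tnth t j)) = if i == j then uval (tnth t j) else 0].
Proof.
move=> ind; apply: (dual_derivations charF (t := fun i => uval (tnth t i))) => i hi.
apply: ind.
have dep x y z : (forall j, j != i -> [\/ tnth t j = x, tnth t j = y | tnth t j = z]) ->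
    dependent (uval x) (uval y) (uval z) (uval (tnth t i)).
  have h0 := subfield2_squares charF; have h1 := subfield2_adjoin h0 (uval x).
  have h2 := subfield2_adjoin h1 (uval y).
  move=> h; apply: (hi (adjoin _ _)); first exact: subfield2_adjoin.
  move=> _ [j /= ji <-]; case: (h j ji) => ->; last exact: mem_adjoin.
    by do 2![apply: sub_adjoin => //]; exact: mem_adjoin.
  by apply: sub_adjoin => //; exact: mem_adjoin.
have tE (j k : 'I_4) : j = k :> nat -> tnth t j = tnth t k.
  by move=> e; congr tnth; apply: val_inj.
case: i hi dep => -[|[|[|[|//]]]] p hi dep.
- apply: Or41; rewrite (tE (@Ordinal 4 0 isT) (Ordinal p)) //.
  apply: dep => -[[|[|[|[|//]]]] q] //= _.
  + by apply: Or33; apply: tE.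
  + by apply: Or31; apply: tE.
  + by apply: Or32; apply: tE.
- apply: Or42; rewrite (tE (@Ordinal 4 1 isT) (Ordinal p)) //.
  apply: dep => -[[|[|[|[|//]]]] q] //= _.
  + by apply: Or33; apply: tE.
  + by apply: Or31; apply: tE.
  + by apply: Or32; apply: tE.
- apply: Or43; rewrite (tE (@Ordinal 4 2 isT) (Ordinal p)) //.
  apply: dep => -[[|[|[|[|//]]]] q] //= _.
  + by apply: Or31; apply: tE.
  + by apply: Or32; apply: tE.
  + by apply: Or33; apply: tE.
- apply: Or44; rewrite (tE (@Ordinal 4 3 isT) (Ordinal p)) //.
  apply: dep => -[[|[|[|[|//]]]] q] //= _.
  + by apply: Or31; apply: tE.
  + by apply: Or32; apply: tE.
  + by apply: Or33; apply: tE.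
Qed.

End Dependence.

Theorem theorem4p2 (F : fieldType) (charF : 2%N \in [pchar F]) (a b c d : units F) :
  (exists alpha beta : units F,
     K2_emb (ksym_mod 2 [tuple a; b] + ksym_mod 2 [tuple c; d])
       = ksym_mod 4 [tuple alpha; beta])
  <-> ksym_mod 2 [tuple a; b; c; d] = 0.
Proof.
have K2E (x y : units F) : ksym_mod 2 [tuple x; y] = K2 (uval x) (uval y).
  by rewrite /K2 !unit_of_val.
have K4E : ksym_mod 2 [tuple a; b; c; d] = K4 (uval a) (uval b) (uval c) (uval d).
  by rewrite /K4 !unit_of_val.
(* With a dependence both sides of the equivalence hold; without one both fail. *)
have [dep|/(dual_derivations4 charF (t := [tuple a; b; c; d]))] :=
  pselect (some_dependent (uval a) (uval b) (uval c) (uval d)).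
  rewrite K4E !K2E; split=> _; first by apply: K4_some_dependent; rewrite ?uvalP.
  by apply: (mod4_symbol_some_dependent charF) dep; exact: uvalP.
move=> [D [hD DC Did Dt]]; split=> [[alpha [beta]]|].
  by move/(K2_emb_not_symbol charF hD DC Did Dt).
by move/(ksym_mod2_dual charF hD Dt).
Qed.
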